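(* Let $G$ be a compact Lie group, let $H$ be a Lie group, let $\Theta:G\to\mathrm{Aut}(H)$ be an action of $G$ on $H$, and let $D:G\to H$ be a crossed homomorphism with respect to $\Theta$. Then any deformation $\mathcal D:G\times\mathbb R\to H$ of $D$ is trivial; hence all crossed homomorphisms $G\to H$ with respect to $\Theta$ are rigid.
   Context: An action $\Theta:G\to\mathrm{Aut}(H)$ is a (smooth) action of $G$ on $H$ by Lie group automorphisms. A crossed homomorphism with respect to $\Theta$ is a smooth map $D:G\to H$ with $D(ab)=D(a)\cdot(\Theta(a)D(b))$ for all $a,b\in G$. A deformation of $D$ is a smooth map $\mathcal D:G\times\mathbb R\to H$ such that $\mathcal D(\cdot,0)=D$ and $D_t=\mathcal D(\cdot,t)$ is a crossed homomorphism with respect to $\Theta$ for every $t\in\mathbb R$. The deformation is trivial if there are an interval $I=(-\varepsilon,\varepsilon)\subset\mathbb R$ and a smooth map $\tau:I\to H$ with $\tau(0)=e_H$ and $D_t(a)=\tau(t)\,D(a)\,\Theta(a)(\tau(t)^{-1})$ for all $a\in G$, $t\in I$. $D$ is rigid if all deformations of $D$ are trivial. *)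

(* Defs.v *)
From HB Require Import structures.
From mathcomp Require Import all_boot all_order all_algebra.
From mathcomp Require Import all_classical all_reals all_analysis.

Set Implicit Arguments.
Unset Strict Implicit.
Unset Printing Implicit Defensive.

Import Order.TTheory GRing.Theory Num.Theory.
Import numFieldNormedType.Exports.

Local Open Scope classical_set_scope.
Local Open Scope ring_scope.

(* [U] is meant to be open, so that being differentiable at the points of [U]
   only depends on the values of [f] in [U]. In finite dimension, [f] is
   C^(k+1) iff it is differentiable and its directional derivatives are C^k. *)
Fixpoint Ck_on (R : realType) (V W : normedModType R) (k : nat)
    (U : set V) (f : V -> W) : Prop :=
  match k with
  | 0 => forall x, U x -> {for x, continuous f}
  | k'.+1 => (forall x, U x -> differentiable f x) /\
             (forall v : V, Ck_on k' U (fun x => 'D_v f x))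
  end.

Definition Cinfty_on (R : realType) (V W : normedModType R)
    (U : set V) (f : V -> W) : Prop :=
  forall k, Ck_on k U f.

(* A chart of [T] with values in [E]. The values of [cmap] outside of [cdom],
   and of [cinv] outside of [cmap @` cdom], are irrelevant. *)
Record chart (T E : Type) := Chart {
  cdom : set T;
  cmap : T -> E;
  cinv : E -> T
}.

Record is_chart (R : realType) (T : topologicalType) (E : normedModType R)
    (c : chart T E) : Prop := IsChart {
  chart_open_dom : open (cdom c);
  chart_open_codom : open (cmap c @` cdom c);
  chart_continuous : forall x, cdom c x -> {for x, continuous (cmap c)};
  chart_inv_continuous :
    forall y, (cmap c @` cdom c) y -> {for y, continuous (cinv c)};
  chartK : forall x, cdom c x -> cinv c (cmap c x) = x
}.

Record is_smooth_atlas (R : realType) (T : topologicalType)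
    (E : normedModType R) (A : set (chart T E)) : Prop := IsSmoothAtlas {
  atlas_chart : forall c, A c -> is_chart c;
  atlas_cover : forall x : T, exists2 c, A c & cdom c x;
  atlas_transition : forall c d, A c -> A d ->
    Cinfty_on (cmap c @` (cdom c `&` cdom d)) (cmap d \o cinv c)
}.

Record is_smooth_manifold (R : realType) (T : topologicalType)
    (E : normedModType R) (A : set (chart T E)) : Prop := IsSmoothManifold {
  manifold_hausdorff : hausdorff_space T;
  manifold_second_countable : @second_countable T;
  manifold_atlas : is_smooth_atlas A
}.

(* The standard smooth structure of a vector space. *)
Definition vec_atlas (R : realType) (E : normedModType R) : set (chart E E) :=
  [set Chart setT id id].

Definition prod_chart (T E T' E' : Type) (c : chart T E) (c' : chart T' E') :
    chart (T * T') (E * E') :=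
  Chart (cdom c `*` cdom c')
        (fun x => (cmap c x.1, cmap c' x.2))
        (fun y => (cinv c y.1, cinv c' y.2)).

Definition prod_atlas (T E T' E' : Type)
    (A : set (chart T E)) (A' : set (chart T' E')) :
    set (chart (T * T') (E * E')) :=
  [set prod_chart c c' | c in A & c' in A'].

(* Smoothness of [f] on the open subset [O] of its domain. By continuity, the
   set on which each coordinate expression is required to be smooth is open. *)
Definition smooth_on (R : realType) (T T' : topologicalType)
    (E E' : normedModType R) (A : set (chart T E)) (A' : set (chart T' E'))
    (O : set T) (f : T -> T') : Prop :=
  (forall x, O x -> {for x, continuous f}) /\
  (forall c c', A c -> A' c' ->
     Cinfty_on (cmap c @` (O `&` cdom c `&` f @^-1` cdom c'))
               (cmap c' \o f \o cinv c)).

Definition smooth (R : realType) (T T' : topologicalType)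
    (E E' : normedModType R) (A : set (chart T E)) (A' : set (chart T' E'))
    (f : T -> T') : Prop :=
  smooth_on A A' setT f.

HB.mixin Record TopologicalGroup_isLieGroup (R : realType) G
    of Topological G & Group G := {
  lie_dim : nat;
  lie_atlas : set (chart G 'rV[R]_lie_dim);
  lie_manifold : is_smooth_manifold lie_atlas;
  smooth_mulg : smooth (prod_atlas lie_atlas lie_atlas) lie_atlas
    (fun p : G * G => (p.1 * p.2)%g);
  smooth_invg : smooth lie_atlas lie_atlas (fun x : G => x^-1%g)
}.

#[short(type="lieGroupType")]
HB.structure Definition LieGroup (R : realType) :=
  { G of Topological G & Group G & TopologicalGroup_isLieGroup R G }.

Section CrossedHomomorphisms.
Variables (R : realType) (G H : lieGroupType R).

Local Notation atlasG := (@lie_atlas R G).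
Local Notation atlasH := (@lie_atlas R H).
Local Notation atlasR := (@vec_atlas R R).

Record is_lie_automorphism (phi : H -> H) : Prop := IsLieAutomorphism {
  lie_autM : {morph phi : x y / (x * y)%g};
  lie_aut_smooth : smooth atlasH atlasH phi;
  lie_aut_inverse : exists psi : H -> H,
    [/\ cancel phi psi, cancel psi phi & smooth atlasH atlasH psi]
}.

Record is_lie_action (Theta : G -> H -> H) : Prop := IsLieAction {
  lie_action_aut : forall a, is_lie_automorphism (Theta a);
  lie_action1 : forall x, Theta 1%g x = x;
  lie_actionM : forall a b x, Theta (a * b)%g x = Theta a (Theta b x);
  lie_action_smooth :
    smooth (prod_atlas atlasG atlasH) atlasH
      (fun p : G * H => Theta p.1 p.2)
}.

Variable Theta : G -> H -> H.

Record is_crossed_hom (D : G -> H) : Prop := IsCrossedHom {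
  crossed_hom_smooth : smooth atlasG atlasH D;
  crossed_homM : forall a b, D (a * b)%g = (D a * Theta a (D b))%g
}.

Record is_deformation (D : G -> H) (DD : G * R -> H) : Prop := IsDeformation {
  deformation_smooth : smooth (prod_atlas atlasG atlasR) atlasH DD;
  deformation0 : forall a, DD (a, 0) = D a;
  deformation_crossed_hom : forall t, is_crossed_hom (fun a => DD (a, t))
}.

Definition is_trivial_deformation (D : G -> H) (DD : G * R -> H) : Prop :=
  exists (eps : R) (tau : R -> H),
    [/\ 0 < eps,
        smooth_on atlasR atlasH `]- eps, eps[ tau,
        tau 0 = 1%g
      & forall (a : G) (t : R), - eps < t < eps ->
          DD (a, t) = (tau t * D a * Theta a ((tau t)^-1))%g].

Definition is_rigid (D : G -> H) : Prop :=
  forall DD : G * R -> H, is_deformation D DD -> is_trivial_deformation D DD.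

End CrossedHomomorphisms.

(* Main.v *)
From HB Require Import structures.
Require Import Defs.
From mathcomp Require Import all_boot all_order all_algebra.
From mathcomp Require Import all_classical all_reals all_analysis.
From mathcomp Require Import ring lra.

(** A crossed homomorphism [D_t] makes [G] act on [H] by
    [a . h = D_t(a) Theta(a)(h) D(a)^-1], and [h] is fixed by this action iff
    [D_t(a) = h D(a) Theta(a)(h^-1)] for all [a]. So the deformation is trivial
    as soon as these actions have fixed points [tau(t)] that depend smoothly on
    [t], with [tau(0) = 1]; and 1 is a fixed point for [t = 0], because
    [D_0 = D].

    Adding the time as a coordinate gives one action of [G] near the point
    [(0, 1)] of [R * H], which fixes this point and preserves the time. Since [G]
    is compact, the action can be linearized there (Bochner): if [L_a] is the
    derivative of the action of [a] at the fixed point, the mean [Phi] of the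
    maps [L_a^-1 \o a] over [G] has the identity as derivative at the fixed point
    and satisfies [Phi \o b = L_b \o Phi]. The mean of the vectors [L_a (1, 0)] is
    an invariant vector [w] whose time component is 1, and the curve [y] with
    [Phi (y t) = t w] consists of fixed points, the time of [y t] being [t]. Its
    second component is [tau]. This is [fixed_curve], applied in
    [deformation_trivial].

    Two tools carry this argument. The mean of a continuous function on a compact
    group is the constant that its averages over finitely many translates
    approach uniformly ([lavg_near_const], [meanP]); it commutes with derivatives
    in a parameter because compactness makes all the estimates uniform
    ([Ck_mean]). The curve [y] comes from the contraction principle, and its
    smoothness from the linear system satisfied by its derivative
    ([inverse_curve], [Ck_lincomb_solution]). *)

Set Implicit Arguments.
Unset Strict Implicit.
Unset Printing Implicit Defensive.

Import Order.TTheory GRing.Theory Num.Theory.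
Import numFieldNormedType.Exports.

Local Open Scope classical_set_scope.
Local Open Scope ring_scope.

(** * Differentiability at a point *)

Section Differentiability.
Variable R : realType.
Implicit Types V W X : normedModType R.

(** The epsilon form of differentiability: the estimates proved below are
    explicit inequalities, and this is where they enter and leave. *)
Lemma differentiable_boundP V W (f : V -> W) x (L : {linear V -> W}) :
  continuous L ->
  (forall e, 0 < e -> \forall v \near (0 : V),
      `|f (v + x) - f x - L v| <= e * `|v|) ->
  differentiable f x /\ 'd f x = L :> (V -> W).
Proof.
move=> cL bL.
have H : f \o shift x = cst (f x) + L +o_ (0 : V) id.
  apply/eqaddoP => e e0; near=> v.
  rewrite /= -![(_ + _ : V -> W) _]/(_ + _) -[(- _ : V -> W) _]/(- _) /= opprD addrA.
  near: v; exact: bL.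
have E := diff_unique cL H.
by split => //; apply/diff_locallyP; rewrite E.
Unshelve. all: by end_near. Qed.

Lemma differentiable_bound V W (f : V -> W) x : differentiable f x ->
  forall e, 0 < e -> \forall v \near (0 : V),
      `|f (v + x) - f x - 'd f x v| <= e * `|v|.
Proof.
move=> /diff_locallyP [_ H] e e0.
move/eqaddoP : H => /(_ e e0) H; near=> v.
have : `|(f \o shift x - (cst (f x) + 'd f x)) v| <= e * `|v| by near: v.
by rewrite -![(_ + _ : V -> W) _]/(_ + _) -[(- _ : V -> W) _]/(- _) /= opprD addrA.
Unshelve. all: by end_near. Qed.

Lemma near_eq_differentiable V W (f g : V -> W) x :
  (\near x, f x = g x) -> differentiable f x -> differentiable g x.
Proof.
move=> fg df.
have gx : f x = g x := nbhs_singleton fg.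
apply: (proj1 (differentiable_boundP (diff_continuous df) _)) => e e0.
have fg' : \forall v \near (0 : V), f (v + x) = g (v + x).
  have cx : (fun v : V => v + x) @ (0 : V) --> 0 + x.
    by apply: cvgD; [exact: cvg_id|exact: cvg_cst].
  by rewrite add0r in cx; exact: (cx _ fg).
near=> v; rewrite -gx -(near fg' v) //; near: v.
exact: differentiable_bound.
Unshelve. all: by end_near. Qed.

Lemma derive_comp V W X (f : V -> W) (g : W -> X) x v :
  differentiable f x -> differentiable g (f x) ->
  'D_v (g \o f) x = 'D_('D_v f x) g (f x).
Proof.
move=> df dg; rewrite (deriveE _ (differentiable_comp df dg)) diff_comp //=.
by rewrite !deriveE.
Qed.

Lemma derive_linear V W (l : {linear V -> W}) x v :
  continuous l -> 'D_v l x = l v.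
Proof.
by move=> cl; rewrite (deriveE _ (linear_differentiable x cl)) diff_lin.
Qed.

End Differentiability.

(** * Families of maps of class C^k with a continuous parameter *)

Section FiniteDimension.
Variable R : realType.

(** Coordinates reduce statements on vector-valued maps to scalar ones, and
    the derivative in an arbitrary direction to finitely many directions. *)
Definition fin_dim (V : normedModType R) : Prop :=
  exists (n : nat) (e : 'I_n -> V) (c : 'I_n -> {linear V -> R}),
    (forall i, continuous (c i)) /\ (forall v, v = \sum_i c i v *: e i).

End FiniteDimension.

Section CkFamilies.
Variable R : realType.
Variable T : topologicalType.
Implicit Types V W X : normedModType R.

(** The maps [F (a, _)] are of class C^k, and their derivatives are continuous
    in both variables together. Continuity in [a] is imposed at each order,
    so that over a compact parameter space the derivatives vary uniformly and
    can be exchanged with a mean over [a]. *)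
Fixpoint Ck_fam V W (k : nat) (O : set (T * V)) (F : T * V -> W) : Prop :=
  (forall p, O p -> {for p, continuous F}) /\
  if k is k'.+1 then
    (forall p, O p -> differentiable (fun x => F (p.1, x)) p.2) /\
    (forall v, Ck_fam k' O (fun p => 'D_v (fun x => F (p.1, x)) p.2))
  else True.

Lemma Ck_fam_continuous V W k (O : set (T * V)) (F : T * V -> W) :
  Ck_fam k O F -> forall p, O p -> {for p, continuous F}.
Proof. by case: k => [|k] []. Qed.

Lemma Ck_famW V W k (O : set (T * V)) (F : T * V -> W) :
  Ck_fam k.+1 O F -> Ck_fam k O F.
Proof.
elim: k F => [|k IH] F; first by case.
by case=> cF [dF DF]; split=> //; split=> // v; exact: (IH _ (DF v)).
Qed.

Lemma Ck_fam_sub V W k (O O' : set (T * V)) (F : T * V -> W) :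
  O' `<=` O -> Ck_fam k O F -> Ck_fam k O' F.
Proof.
move=> sO; elim: k F => [|k IH] F /=; first by case=> cF _; split=> // p /sO /cF.
case=> cF [dF DF]; split; first by move=> p /sO /cF.
by split=> [p /sO /dF //|v]; exact: (IH _ (DF v)).
Qed.

(** Being of class C^k is a local property, so it can be checked in charts
    chosen around each point. *)
Lemma Ck_fam_local V W k (O : set (T * V)) (F : T * V -> W) :
  (forall p, O p -> exists2 O' : set (T * V), O' p & Ck_fam k O' F) ->
  Ck_fam k O F.
Proof.
elim: k F => [|k IH] F /= lF.
  by split=> // p /lF[N Np [cF _] ]; exact: cF.
split; first by move=> p /lF[N Np [cF _] ]; exact: cF.
split; first by move=> p /lF[N Np [_ [dF _] ] ]; exact: dF.
by move=> v; apply: IH => p /lF[N Np [_ [_ DF] ] ]; exists N.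
Qed.

Lemma near_slice V (O : set (T * V)) (p : T * V) :
  open O -> O p -> \forall x \near p.2, O (p.1, x).
Proof.
move=> oO Op.
have /(_ O) : {for p.2, continuous (fun x : V => (p.1, x))}.
  by apply: cvg_pair; [exact: cvg_cst|exact: cvg_id].
by apply; rewrite -surjective_pairing; exact: open_nbhs_nbhs.
Qed.

Lemma open_setTX V (U : set V) : open U -> open ([set: T] `*` U).
Proof.
move=> oU; have -> : [set: T] `*` U = snd @^-1` U.
  by apply/seteqP; split=> [p []|p].
by apply: open_comp oU => p _; exact: cvg_snd.
Qed.

Lemma eq_Ck_fam V W k (O : set (T * V)) (F G : T * V -> W) :
  open O -> (forall p, O p -> F p = G p) -> Ck_fam k O F -> Ck_fam k O G.
Proof.
move=> oO; elim: k F G => [|k IH] F G FG /=.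
  case=> cF _; split=> // p Op; rewrite /prop_for /continuous_at -FG//.
  apply: cvg_trans (cF _ Op); apply: near_eq_cvg.
  have nO : nbhs p O by exact: open_nbhs_nbhs.
  by apply: filterS nO => q; exact: FG.
case=> cF [dF DF]; split.
  move=> p Op; rewrite /prop_for /continuous_at -FG//.
  apply: cvg_trans (cF _ Op); apply: near_eq_cvg.
  have nO : nbhs p O by exact: open_nbhs_nbhs.
  by apply: filterS nO => q; exact: FG.
have nFG p : O p -> \forall x \near p.2, F (p.1, x) = G (p.1, x).
  by move=> Op; apply: filterS (near_slice oO Op) => x; exact: FG.
split=> [p Op|v]; first exact: near_eq_differentiable (nFG _ Op) (dF _ Op).
by apply: IH (DF v) => p Op; apply: near_eq_derive; exact: nFG.
Qed.

Lemma Ck_fam_param V W k (O : set (T * V)) (u : T -> W) :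
  (forall p, O p -> {for p.1, continuous u}) -> Ck_fam k O (fun p => u p.1).
Proof.
elim: k u => [|k IH] u cu /=;
  have cF p : O p -> {for p, continuous (fun p : T * V => u p.1)}.
- by move=> Op; apply: continuous_comp; [exact: cvg_fst|exact: cu].
- by [].
- by move=> Op; apply: continuous_comp; [exact: cvg_fst|exact: cu].
split=> //; split=> [p _|v]; first exact: differentiable_cst.
under [X in Ck_fam _ _ X]eq_fun do rewrite derive_cst.
by apply: (IH (cst 0)) => p _; exact: cst_continuous.
Qed.

Lemma Ck_fam_linear V W X k (O : set (T * V)) (F : T * V -> W)
    (L : {linear W -> X}) : open O ->
  continuous L -> Ck_fam k O F -> Ck_fam k O (L \o F).
Proof.
move=> oO cL; elim: k F => [|k IH] F /=.
  by case=> cF _; split=> // p Op; apply: continuous_comp; [exact: cF|exact: cL].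
case=> cF [dF DF]; split.
  by move=> p Op; apply: continuous_comp; [exact: cF|exact: cL].
split.
  move=> p Op; apply: (@differentiable_comp _ _ _ _ (fun x => F (p.1, x)) L).
    exact: dF.
  exact: linear_differentiable.
move=> v; apply: eq_Ck_fam (IH _ (DF v)) => // p Op /=.
have dFp := dF _ Op.
have dL : differentiable L (F (p.1, p.2)) by exact: linear_differentiable.
rewrite (deriveE _ dFp) (deriveE _ (differentiable_comp dFp dL)).
by rewrite diff_comp //= diff_lin.
Qed.

Lemma Ck_famD V W k (O : set (T * V)) (F G : T * V -> W) : open O ->
  Ck_fam k O F -> Ck_fam k O G -> Ck_fam k O (F \+ G).
Proof.
move=> oO; elim: k F G => [|k IH] F G /= [cF +] [cG +].
  by split=> // p Op; apply: cvgD; [exact: cF|exact: cG].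
move=> [dF DF] [dG DG]; split.
  by move=> p Op; apply: cvgD; [exact: cF|exact: cG].
split=> [p Op|v].
  by apply: differentiableD; [exact: dF|exact: dG].
apply: eq_Ck_fam (IH _ _ (DF v) (DG v)) => // p Op /=.
by rewrite deriveD //; apply: diff_derivable; [exact: dF|exact: dG].
Qed.

Lemma Ck_fam_sum V W k (O : set (T * V)) n (F : 'I_n -> T * V -> W) : open O ->
  (forall i, Ck_fam k O (F i)) -> Ck_fam k O (fun p => \sum_i F i p).
Proof.
move=> oO cF.
have -> : (fun p => \sum_i F i p) = \big[(fun f g => f \+ g)/cst 0]_i F i.
  apply/funext => p; elim/big_rec2 : _ => [//|i y f _ -> //].
elim/big_ind : _ => [|f g cf cg|i _]; last exact: cF.
  by apply: (Ck_fam_param _ _ (u := cst 0)) => p _; exact: cst_continuous.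
exact: Ck_famD.
Qed.

Lemma Ck_famM V k (O : set (T * V)) (F G : T * V -> R) : open O ->
  Ck_fam k O F -> Ck_fam k O G -> Ck_fam k O (fun p => F p * G p).
Proof.
move=> oO; elim: k F G => [|k IH] F G /= cF cG.
  case: cF cG => cF _ [cG _].
  by split=> // p Op; apply: cvgM; [exact: cF|exact: cG].
case: (cF) (cG) => cF0 [dF DF] [cG0 [dG DG]]; split.
  by move=> p Op; apply: cvgM; [exact: cF0|exact: cG0].
split=> [p Op|v].
  by apply: differentiableM; [exact: dF|exact: dG].
have cF' : Ck_fam k O F by exact: Ck_famW.
have cG' : Ck_fam k O G by exact: Ck_famW.
apply: eq_Ck_fam (Ck_famD oO (IH _ _ cF' (DG v)) (IH _ _ cG' (DF v))) => //.
move=> p Op /=.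
have := @deriveM _ _ (fun x => F (p.1, x)) (fun x => G (p.1, x)) p.2 v
  (diff_derivable (dF _ Op)) (diff_derivable (dG _ Op)).
by move=> ->; rewrite /= -surjective_pairing.
Qed.

Lemma Ck_fam_pair V W X k (O : set (T * V)) (F : T * V -> W) (G : T * V -> X) :
  open O ->
  Ck_fam k O F -> Ck_fam k O G -> Ck_fam k O (fun p => (F p, G p)).
Proof.
move=> oO; elim: k F G => [|k IH] F G /= [cF +] [cG +].
  by split=> // p Op; apply: cvg_pair; [exact: cF|exact: cG].
move=> [dF DF] [dG DG]; split.
  by move=> p Op; apply: cvg_pair; [exact: cF|exact: cG].
split=> [p Op|v].
  by apply: differentiable_pair; [exact: dF|exact: dG].
apply: eq_Ck_fam (IH _ _ (DF v) (DG v)) => // p Op /=.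
have dFp := dF _ Op; have dGp := dG _ Op.
rewrite (deriveE _ (differentiable_pair dFp dGp)) diff_pair //.
by rewrite !deriveE.
Qed.

Lemma Ck_fam_slice V W k (O : set (T * V)) (F : T * V -> W) (a : T) :
  Ck_fam k O F -> Ck_on k [set x | O (a, x)] (fun x => F (a, x)).
Proof.
elim: k F => [|k IH] F /= [cF +].
  move=> _ x Ox; apply: (@continuous_comp _ _ _ (fun x => (a, x)) F).
    by apply: cvg_pair; [exact: cvg_cst|exact: cvg_id].
  exact: cF.
move=> [dF DF]; split=> [x Ox|v]; first exact: (dF _ Ox).
exact: IH (DF v).
Qed.

Lemma Ck_fam_snd V W k (U : set V) (f : V -> W) :
  Ck_on k U f -> Ck_fam k (setT `*` U) (fun p => f p.2).
Proof.
have cf2 (g : V -> W) : (forall x, U x -> {for x, continuous g}) ->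
    forall p, (setT `*` U) p -> {for p, continuous (fun p : T * V => g p.2)}.
  by move=> cg p [_ Up]; apply: continuous_comp; [exact: cvg_snd|exact: cg].
elim: k f => [|k IH] f /=; first by move=> /cf2.
case=> df Df; split; first by apply: cf2 => x /df /differentiable_continuous.
split=> [p [_ /df]//|v]; exact: IH (Df v).
Qed.


Lemma Ck_fam_scalel V W k (O : set (T * V)) (r : T * V -> R) (w : W) :
  open O -> Ck_fam k O r -> Ck_fam k O (fun p => r p *: w).
Proof.
move=> oO; elim: k r => [|k IH] r /= [cr +].
  by split=> // p Op; apply: cvgZr_tmp; exact: cr.
move=> [dr Dr]; split; first by move=> p Op; apply: cvgZr_tmp; exact: cr.
split=> [p Op|v]; first by apply: differentiableZl; exact: dr.
apply: eq_Ck_fam (IH _ (Dr v)) => // p Op /=.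
have drp := dr _ Op.
by rewrite (deriveE _ (differentiableZl w drp)) diffZl // deriveE.
Qed.

Lemma Ck_famZ V W k (O : set (T * V)) (r : T * V -> R) (F : T * V -> W) :
  fin_dim W -> open O -> Ck_fam k O r -> Ck_fam k O F ->
  Ck_fam k O (fun p => r p *: F p).
Proof.
move=> [n [e [c [cc ce]]]] oO cr cF.
have -> : (fun p => r p *: F p) =
    (fun p => \sum_i (r p * (c i \o F) p) *: e i).
  apply/funext => p; rewrite [in LHS](ce (F p)) scaler_sumr.
  by apply: eq_bigr => i _; rewrite scalerA.
apply: Ck_fam_sum => // i; apply: Ck_fam_scalel => //; apply: Ck_famM => //.
exact: Ck_fam_linear.
Qed.

(** The derivative of [g \o F] in the direction [v] is a combination of the
    partial derivatives of [g], taken along [F], whose coefficients are the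
    coordinates of the derivative of [F]. All these maps are of class C^k when
    [g] and [F] are of class C^(k+1), hence the induction. *)
Lemma Ck_fam_comp V W X k (O : set (T * V)) (U : set W) (F : T * V -> W)
    (g : W -> X) : fin_dim W -> fin_dim X -> open O ->
  (forall p, O p -> U (F p)) ->
  Ck_fam k O F -> Ck_on k U g -> Ck_fam k O (g \o F).
Proof.
move=> fW fX oO FU; have [n [e [c [cc ce]]]] := fW.
elim: k g => [|k IH] g cF /=.
  move=> cg; split=> // p Op; apply: continuous_comp.
    exact: (Ck_fam_continuous cF).
  exact/cg/FU.
move=> [dg Dg]; have [cF0 [dF DF]] := cF; split.
  move=> p Op; apply: continuous_comp; first exact: cF0.
  exact/differentiable_continuous/dg/FU.
have dgF p : O p -> differentiable g (F (p.1, p.2)).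
  by move=> Op; apply: dg; rewrite -surjective_pairing; exact: FU.
split=> [p Op|v].
  by apply: (@differentiable_comp _ _ _ _ (fun x => F (p.1, x)) g);
    [exact: dF|exact: dgF].
have cF' : Ck_fam k O F by exact: Ck_famW.
pose G p := \sum_i (c i \o (fun p => 'D_v (fun x => F (p.1, x)) p.2)) p *:
   ('D_(e i) g \o F) p.
apply: (@eq_Ck_fam _ _ _ _ G) => // [p Op|]; last first.
  apply: Ck_fam_sum => // i; apply: Ck_famZ => //; last exact: IH.
  exact: Ck_fam_linear (DF v).
have dFp := dF _ Op; have dgp := dgF _ Op.
rewrite (deriveE _ (differentiable_comp dFp dgp)) diff_comp //=.
rewrite -(deriveE v dFp) [X in _ = 'd g _ X]ce linear_sum; apply: eq_bigr => i _.
by rewrite linearZ /= -(deriveE _ dgp) -surjective_pairing.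
Qed.

End CkFamilies.

Section FiniteDimensionalSpaces.
Variable R : realType.

Lemma fin_dim_scalar : fin_dim R.
Proof.
exists 1, (fun=> 1), (fun=> idfun); split=> [i x|v]; first exact: cvg_id.
by rewrite big_ord1 /= /GRing.scale /= mulr1.
Qed.

Lemma fin_dim_row n : fin_dim 'rV[R]_n.
Proof.
have lin i : linear (fun v : 'rV[R]_n => v 0 i : R).
  by move=> a u v; rewrite !mxE.
pose cM i := GRing.isLinear.Build _ _ _ _ _ (lin i).
pose c i : {linear 'rV[R]_n -> R} := HB.pack (fun v : 'rV[R]_n => v 0 i : R) (cM i).
exists n, (delta_mx 0), c; split=> [i|v]; first exact: coord_continuous.
exact: row_sum_delta.
Qed.

Lemma fin_dim_prod (V W : normedModType R) :
  fin_dim V -> fin_dim W -> fin_dim (V * W)%type.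
Proof.
move=> [n [e [c [cc ce]]]] [m [f [d [cd df]]]].
pose e' (i : 'I_(n + m)) : V * W :=
  match fintype.split i with inl j => (e j, 0) | inr j => (0, f j) end.
pose c' (i : 'I_(n + m)) : {linear (V * W)%type -> R} :=
  match fintype.split i with inl j => c j \o fst | inr j => d j \o snd end.
exists (n + m)%N, e', c'; split.
  move=> i; rewrite /c'; case: (fintype.split i) => j x; apply: continuous_comp.
  - exact: cvg_fst.
  - exact: cc.
  - exact: cvg_snd.
  - exact: cd.
case=> v w; rewrite big_split_ord /=.
under eq_bigr do rewrite /c' /e' (unsplitK (inl _)) /=.
under [X in _ = _ + X]eq_bigr do rewrite /c' /e' (unsplitK (inr _)) /=.
rewrite [RHS]surjective_pairing; congr (_, _).
  rewrite raddfD /= !(raddf_sum fst) /= [X in _ + X]big1 ?addr0 => [|j _].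
    exact: ce.
  exact: scaler0.
rewrite raddfD /= !(raddf_sum snd) /= [X in X + _]big1 ?add0r => [|j _].
  exact: df.
exact: scaler0.
Qed.

End FiniteDimensionalSpaces.

(** * The invariant mean on a compact Lie group *)

Section LieGroupContinuity.
Variables (R : realType) (G : lieGroupType R).

Lemma lie_mulg_continuous : continuous (fun p : G * G => (p.1 * p.2)%g).
Proof. by move=> p; apply: (@smooth_mulg R G).1. Qed.

Lemma lie_invg_continuous : continuous (fun x : G => x^-1%g).
Proof. by move=> p; apply: (@smooth_invg R G).1. Qed.

Lemma continuous_mulg2 (X : topologicalType) (f g : X -> G) :
  continuous f -> continuous g -> continuous (fun x => (f x * g x)%g).
Proof.
move=> cf cg x.
apply: (@continuous_comp _ _ _ (fun x => (f x, g x))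
  (fun p : G * G => (p.1 * p.2)%g)).
  by apply: cvg_pair; [exact: cf|exact: cg].
exact: lie_mulg_continuous.
Qed.

End LieGroupContinuity.

Section Averages.
Variables (R : realType) (G : lieGroupType R).
Implicit Types (s l : seq G) (f g : G -> R).

(** Averages over finitely many translates take the place of the Haar
    integral. Left and right averages commute, which is why the constants that
    they approach have to agree. *)
Definition lavg s f (x : G) : R := (size s)%:R^-1 * \sum_(a <- s) f (a * x)%g.
Definition ravg s f (x : G) : R := (size s)%:R^-1 * \sum_(a <- s) f (x * a)%g.

Lemma size_neq0 s : s != [::] -> (size s)%:R != 0 :> R.
Proof. by move=> s0; rewrite pnatr_eq0 size_eq0. Qed.

Lemma sum_const_seq s (c : R) : \sum_(a <- s) c = (size s)%:R * c.
Proof. by rewrite big_const_seq count_predT iter_addr_0 mulr_natl. Qed.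

Lemma avg_ge (s : seq G) (h : G -> R) (m : R) : s != [::] ->
  (forall a, m <= h a) -> m <= (size s)%:R^-1 * \sum_(a <- s) h a.
Proof.
move=> s0 mh; rewrite ler_pdivlMl ?lt0r ?size_neq0 //=.
rewrite -sum_const_seq; apply: ler_sum => a _; exact: mh.
Qed.

Lemma avg_norm_le (s : seq G) (h : G -> R) (m : R) : s != [::] ->
  (forall a, `|h a| <= m) -> `|(size s)%:R^-1 * \sum_(a <- s) h a| <= m.
Proof.
move=> s0 mh; rewrite ler_norml; apply/andP; split.
  by apply: avg_ge => // a; have := mh a; rewrite ler_norml => /andP[].
rewrite -[leLHS]opprK lerNl -mulrN -sumrN.
by apply: avg_ge => // a; have := mh a; rewrite ler_norml lerN2 => /andP[].
Qed.

Lemma avg_const (s : seq G) (c : R) : s != [::] ->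
  (size s)%:R^-1 * \sum_(a <- s) c = c.
Proof.
by move=> s0; rewrite sum_const_seq mulKf ?size_neq0.
Qed.

Lemma lavgD s f g x : lavg s (f \+ g) x = lavg s f x + lavg s g x.
Proof. by rewrite /lavg big_split mulrDr. Qed.

Lemma lavgZ s (k : R) f x : lavg s (fun x => k * f x) x = k * lavg s f x.
Proof. by rewrite /lavg -mulr_sumr mulrCA. Qed.

Lemma lavg_close s f c e x : s != [::] -> (forall x, `|f x - c| <= e) ->
  `|lavg s f x - c| <= e.
Proof.
move=> s0 fc; rewrite -[c](avg_const _ s0) -mulrBr -sumrB.
exact: avg_norm_le.
Qed.

Definition prods s s' := [seq (b * a)%g | a <- s, b <- s'].

Lemma prods_neq0 s s' : s != [::] -> s' != [::] -> prods s s' != [::].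
Proof. by rewrite -!size_eq0 size_allpairs muln_eq0 => /negPf-> /negPf->. Qed.

Lemma lavg_lavg s s' f : lavg s (lavg s' f) = lavg (prods s s') f.
Proof.
apply/funext => x; rewrite /lavg size_allpairs natrM invfM -mulrA.
congr (_ * _); rewrite big_allpairs_dep mulr_sumr; apply: eq_bigr => a _; congr (_ * _).
by apply: eq_bigr => b _; rewrite mulgA.
Qed.

Lemma lavg_ravg s s' f x : lavg s (ravg s' f) x = ravg s' (lavg s f) x.
Proof.
rewrite /lavg /ravg -!mulr_sumr mulrCA; congr (_ * (_ * _)).
rewrite exchange_big /=; apply: eq_bigr => b _; apply: eq_bigr => a _.
by rewrite mulgA.
Qed.

Lemma lavg_continuous s f : continuous f -> continuous (lavg s f).
Proof.
move=> cf x; apply: cvgM; first exact: cvg_cst.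
apply: cvg_big => [|a _]; first exact: add_continuous.
apply: (@continuous_comp _ _ _ (fun x => (a * x)%g) f); last exact: cf.
by apply: continuous_mulg2 => y; [exact: cvg_cst|exact: cvg_id].
Qed.

Hypothesis compactG : compact [set: G].

Lemma tube_lemma (X : topologicalType) (O : set (G * X)) (x : X) :
  (forall a, nbhs ((a, x) : G * X) O) -> \forall x' \near x, forall a, O (a, x').
Proof.
move=> Ox; have nc := (compact_near_coveringP _).1 compactG.
have : \forall i \near x, [set: G] `<=` (fun a => O (a, i)).
  apply: (nc X (nbhs x) (fun i a => O (a, i))) => a _.
  have [[A B] [nA nB] AB] := Ox a.
  by exists (A, B); [split|case=> a1 x1 [Aa Bx]; exact: (AB (a1, x1))].
by apply: filterS => y Oy a; exact: Oy.
Qed.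

(** Compactness for a family of neighbourhoods indexed by the points: apply
    [near_covering] to the filter of finite sets of points that are large
    enough. *)
Lemma finite_subcover (U : G -> set G) : (forall y, nbhs y (U y)) ->
  exists s : seq G, forall x, exists2 y, y \in s & U y x.
Proof.
move=> nU.
pose F (A : set (seq G)) := exists s, forall s', {subset s <= s'} -> A s'.
have FF : Filter F.
  split; first by exists [::].
    move=> P Q [s Ps] [t Qt]; exists (s ++ t) => s' st; split.
      by apply: Ps => x xs; apply: st; rewrite mem_cat xs.
    by apply: Qt => x xt; apply: st; rewrite mem_cat xt orbT.
  by move=> P Q PQ [s Ps]; exists s => s' /Ps /PQ.
have nc := (compact_near_coveringP _).1 compactG.
have [x _|s] := nc (seq G) F (fun s x => exists2 y, y \in s & U y x) FF.
  exists (U x, [set t : seq G | x \in t]) => /=.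
    by split; [exact: nU|exists [:: x] => s'; apply; rewrite inE].
  by case=> y s [/= Uy xs]; exists x.
by move=> /(_ s (fun _ => id)) H; exists s => x; exact: H.
Qed.

(** Uniform continuity: around each [y], the translations by [y^-1 * x] for
    [x] close to [y] move [f] by at most [e], uniformly in [z]. The net is made
    of the inverses of the centres of a finite subcover. *)
Lemma finite_translate_net f e : continuous f -> 0 < e ->
  exists2 l : seq G, l != [::] &
    forall x, exists2 b, b \in l & forall z, `|f (z * b * x)%g - f z| <= e.
Proof.
move=> cf e0.
pose U (y : G) := [set i : G | forall z, `|f (z * y^-1 * i)%g - f z| <= e].
have nU y : nbhs y (U y).
  pose O := [set p : G * G | `|f (p.1 * y^-1 * p.2)%g - f p.1| < e].
  have oO : open O.
    apply: (@open_comp _ _ (fun p : G * G => `|f (p.1 * y^-1 * p.2)%g - f p.1|)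
      [set r | r < e]); last exact: open_lt.
    move=> p _; apply: cvg_norm; apply: cvgB.
      apply: (@continuous_comp _ _ _ (fun p : G * G => (p.1 * y^-1 * p.2)%g) f).
        apply: continuous_mulg2 => q; last exact: cvg_snd.
        apply: continuous_mulg2 => {}q; [exact: cvg_fst|exact: cvg_cst].
      exact: cf.
    by apply: (@continuous_comp _ _ _ fst f); [exact: cvg_fst|exact: cf].
  have /tube_lemma : forall z, nbhs ((z, y) : G * G) O.
    move=> z; apply: open_nbhs_nbhs; split=> //.
    by rewrite /O /= mulgVK subrr normr0.
  by apply: filterS => i Oi z; apply/ltW; exact: Oi.
have [s sU] := finite_subcover nU.
exists [seq y^-1%g | y <- s].
  by have [y ys _] := sU 1%g; apply: contraTneq ys; case: (s).
move=> x; have [y ys Uy] := sU x.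
by exists y^-1%g; [exact: map_f|exact: Uy].
Qed.

(** Whatever [x] is, some term of the average is close to [f 1], while the
    others are only known to lie in [[m, m + d]]. So one round of averaging
    multiplies the oscillation by [1 - 1 / size l], up to the error [e]. *)
Lemma lavg_contract f e l m d : 0 <= e -> l != [::] ->
  (forall x, exists2 b, b \in l & `|f (b * x)%g - f 1%g| <= e) ->
  (forall x, m <= f x <= m + d) ->
  exists m', forall x, m' <= lavg l f x <=
     m' + (1 - (size l)%:R^-1) * d + 2 * e * (size l)%:R^-1.
Proof.
move=> e0 l0 net bf; set N : R := (size l)%:R.
have N0 : 0 < N by rewrite lt0r size_neq0 //= ler0n.
exists (N^-1 * (f 1%g - e + (N - 1) * m)) => x.
have [b bl fb] := net x.
have NE : N = (size (rem b l))%:R + 1.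
  by rewrite size_rem // natr1 prednK // lt0n size_eq0.
have : (N - 1) * m <= \sum_(a <- rem b l) f (a * x)%g <= (N - 1) * (m + d).
  rewrite NE addrK -!sum_const_seq.
  by apply/andP; split; apply: ler_sum => a _; have /andP[] := bf (a * x)%g.
rewrite /lavg -/N (perm_big _ (perm_to_rem bl)) /= big_cons.
set S := \sum_(a <- _) _; move: fb; rewrite ler_norml => /andP[fb1 fb2] /andP[S1 S2].
apply/andP; split.
  by rewrite ler_pM2l ?invr_gt0 //; lra.
have -> : N^-1 * (f 1%g - e + (N - 1) * m) + (1 - N^-1) * d + 2 * e * N^-1 =
  N^-1 * (f 1%g + e + (N - 1) * (m + d)) by field; rewrite gt_eqF.
by rewrite ler_pM2l ?invr_gt0 //; lra.
Qed.

Lemma lavg_net f l e s : s != [::] ->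
  (forall x, exists2 b, b \in l & forall z, `|f (z * b * x)%g - f z| <= e) ->
  (forall x, exists2 b, b \in l & `|lavg s f (b * x)%g - lavg s f 1%g| <= e).
Proof.
move=> s0 net x; have [b bl fb] := net x; exists b => //.
rewrite /lavg -mulrBr -sumrB; apply: (@avg_norm_le s (fun a => _)) => // a.
by rewrite mulg1 mulgA.
Qed.

(** Iterating [lavg_contract] brings the oscillation down to the error term.
    The net stays valid at each round, because left averages of [f] inherit
    the estimate under right multiplication. *)
Lemma lavg_near_const f e : continuous f -> 0 < e ->
  exists2 s, s != [::] & exists c, forall x, `|lavg s f x - c| <= e.
Proof.
move=> cf e0; have e40 : 0 < e / 4 by rewrite divr_gt0.
have [l l0 net] := finite_translate_net cf e40.
have cf' : {within [set: G], continuous f} by apply: continuous_subspaceT.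
have G0 : [set: G] !=set0 by exists 1%g.
have [M _ fM] := compact_EVT_max G0 compactG cf'.
have [m _ fm] := compact_EVT_min G0 compactG cf'.
set N : R := (size l)%:R.
have N0 : 0 < N by rewrite lt0r size_neq0 //= ler0n.
pose q := 1 - N^-1; pose d0 := f M - f m.
have iter k : exists2 s, s != [::] &
    exists m', forall x, m' <= lavg s f x <= m' + (q ^+ k * d0 + 2 * (e / 4)).
  elim: k => [|k [s s0 [m' IH]]].
    exists [:: 1%g] => //; exists (f m) => x.
    rewrite /lavg big_seq1 invr1 !mul1r mul1g fm ?in_setT //=.
    have : f x <= f M by rewrite fM ?in_setT.
    by rewrite /d0 ?expr0 ?mul1r; lra.
  have [m'' H] := lavg_contract (ltW e40) l0 (lavg_net s0 net) IH.
  exists (prods l s); first exact: prods_neq0.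
  exists m'' => x; rewrite -lavg_lavg; have := H x.
  suff -> : m'' + (1 - (size l)%:R^-1) * (q ^+ k * d0 + 2 * (e / 4)) +
     2 * (e / 4) / (size l)%:R = m'' + (q ^+ k.+1 * d0 + 2 * (e / 4)) by [].
  by rewrite exprS -/N /q; field; rewrite gt_eqF.
have q1 : `|q| < 1.
  have N1 : 1 <= N by rewrite ler1n lt0n size_eq0.
  rewrite ger0_norm /q; first by rewrite ltrBlDr ltrDl invr_gt0.
  by rewrite subr_ge0 invf_le1.
have [k qk] : exists k, q ^+ k * d0 <= e / 4.
  have : (GRing.exp q : R^nat) k * d0 @[k --> \oo] --> 0 * d0.
    by apply: cvgM; [exact: cvg_expr|exact: cvg_cst].
  rewrite mul0r => /cvgr0Pnorm_lt /(_ _ e40) [k _ /(_ k (leqnn k)) H].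
  by exists k; apply: le_trans (ltW H); exact: ler_norm.
have [s s0 [m' H]] := iter k; exists s => //; exists m' => x.
by have /andP[H1 H2] := H x; rewrite ler_norml; apply/andP; split; lra.
Qed.

Lemma ravg_near_const f e : continuous f -> 0 < e ->
  exists2 s, s != [::] & exists c, forall x, `|ravg s f x - c| <= e.
Proof.
move=> cf e0.
have cfV : continuous (fun x => f x^-1%g).
  move=> x; apply: (@continuous_comp _ _ _ (fun x : G => x^-1%g) f).
    exact: lie_invg_continuous.
  exact: cf.
have [s s0 [c H]] := lavg_near_const cfV e0.
exists [seq a^-1%g | a <- s]; first by rewrite -size_eq0 size_map size_eq0.
exists c => x; suff -> : ravg [seq a^-1%g | a <- s] f x =
    lavg s (fun x => f x^-1%g) x^-1%g by [].
rewrite /lavg /ravg size_map big_map; congr (_ * _); apply: eq_bigr => a _.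
by rewrite invgM invgK.
Qed.

(** A lower mean; for continuous [f] it is the constant that left averages of
    [f] approach uniformly. *)
Definition mean f : R :=
  sup [set m | exists2 s, s != [::] & forall x, m <= lavg s f x].

Lemma lavg_le_ravg f s s' m m' : s != [::] -> s' != [::] ->
  (forall x, m <= lavg s f x) -> (forall x, ravg s' f x <= m') -> m <= m'.
Proof.
move=> s0 s'0 mf fm'.
have : m <= ravg s' (lavg s f) 1%g by exact: avg_ge.
move=> /le_trans; apply; rewrite -lavg_ravg -[leRHS]opprK lerNr /lavg -mulrN -sumrN.
by apply: avg_ge => // a; rewrite lerN2.
Qed.

(** The average on both sides at once is close to [c] and to [c']. *)
Lemma lavg_ravg_agree f s s' c c' e e' : s != [::] -> s' != [::] ->
  (forall x, `|lavg s f x - c| <= e) -> (forall x, `|ravg s' f x - c'| <= e') ->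
  `|c - c'| <= e + e'.
Proof.
move=> s0 s'0 Hs Hs'.
have h1 := lavg_close 1%g s0 Hs'.
have h2 : `|ravg s' (lavg s f) 1%g - c| <= e.
  rewrite /ravg -[c](avg_const _ s'0) -mulrBr -sumrB.
  exact: (avg_norm_le s'0 (h := fun a => lavg s f (1 * a)%g - c)).
rewrite lavg_ravg in h1; move: h1 h2.
rewrite !ler_norml => /andP[h1 h2] /andP[h3 h4].
by apply/andP; split; lra.
Qed.

Lemma mean_unique f c : continuous f ->
  (forall e, 0 < e -> exists2 s, s != [::] & forall x, `|lavg s f x - c| <= e) ->
  mean f = c.
Proof.
move=> cf H.
pose S := [set m | exists2 s, s != [::] & forall x, m <= lavg s f x].
have HS e : 0 < e -> S (c - e).
  move=> /H[s s0 Hs]; exists s => // x.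
  by have := Hs x; rewrite ler_norml => /andP[]; lra.
have US : ubound S (c : R).
  move=> m [s s0 ms]; apply/ler_addgt0Pr => e e0.
  have e30 : 0 < e / 3 by rewrite divr_gt0.
  have [s' s'0 [c' Hs']] := ravg_near_const cf e30.
  have m1 : m <= c' + e / 3.
    apply: lavg_le_ravg s0 s'0 ms _ => x.
    by have := Hs' x; rewrite ler_norml => /andP[]; lra.
  have [t t0 Ht] := H _ e30.
  by have := lavg_ravg_agree t0 s'0 Ht Hs'; rewrite ler_norml => /andP[]; lra.
apply/eqP; rewrite eq_le; apply/andP; split.
  by apply: ge_sup => //; exists (c - 1); exact: HS.
apply/ler_addgt0Pr => e e0; rewrite -lerBlDr; apply: ub_le_sup; last exact: HS.
by exists c.
Qed.

Lemma mean_exists f : continuous f -> exists c : R,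
  forall e, 0 < e -> exists2 s, s != [::] & forall x, `|lavg s f x - c| <= e.
Proof.
move=> cf.
pose S := [set m | exists2 s, s != [::] & forall x, m <= lavg s f x].
have S0 : S !=set0.
  have [s s0 [c sc]] := lavg_near_const cf ltr01.
  exists (c - 1), s => // x.
  by have := sc x; rewrite ler_norml => /andP[]; lra.
have subS e c s' : s' != [::] -> (forall x, `|ravg s' f x - c| <= e) ->
    ubound S (c + e).
  move=> s'0 Hs' m [s s0 ms]; apply: lavg_le_ravg s0 s'0 ms _ => x.
  by have := Hs' x; rewrite ler_norml => /andP[]; lra.
have bS : has_ubound S.
  have [s s0 [c sc]] := ravg_near_const cf ltr01.
  by exists (c + 1); exact: subS sc.
exists (sup S) => e e0; have e40 : 0 < e / 4 by rewrite divr_gt0.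
have [s s0 [c sc]] := lavg_near_const cf e40.
have [t t0 [c' tc']] := ravg_near_const cf e40.
have Sc : S (c - e / 4).
  by exists s => // x; have := sc x; rewrite ler_norml => /andP[]; lra.
have h1 : c - e / 4 <= sup S by exact: ub_le_sup.
have h2 : sup S <= c' + e / 4 by apply: ge_sup => //; exact: subS tc'.
have := lavg_ravg_agree s0 t0 sc tc'; rewrite ler_norml => /andP[h3 _].
exists s => // x; have := sc x; rewrite !ler_norml => /andP[k1 k2].
by apply/andP; split; lra.
Qed.

Lemma meanP f e : continuous f -> 0 < e ->
  exists2 s, s != [::] & forall x, `|lavg s f x - mean f| <= e.
Proof.
by move=> cf; have [c H] := mean_exists cf; rewrite (mean_unique cf H); exact: H.
Qed.

Lemma mean_lavg s f : s != [::] -> continuous f -> mean (lavg s f) = mean f.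
Proof.
move=> s0 cf; apply/esym; apply: mean_unique => // e e0.
have [t t0 H] := meanP (lavg_continuous (s := s) cf) e0.
by exists (prods t s); [exact: prods_neq0|move=> x; rewrite -lavg_lavg].
Qed.

(** An average that makes [f] almost constant may be averaged again, to make
    [g] almost constant too, without moving [f] further from its mean. *)
Lemma meanD f g : continuous f -> continuous g ->
  mean (f \+ g) = mean f + mean g.
Proof.
move=> cf cg; apply: mean_unique.
  by move=> x; apply: cvgD; [exact: cf|exact: cg].
move=> e e0; have e20 : 0 < e / 2 by rewrite divr_gt0.
have [s s0 Hs] := meanP cf e20.
have [t t0] := meanP (lavg_continuous (s := s) cg) e20.
rewrite mean_lavg // => Ht.
exists (prods t s); first exact: prods_neq0.
move=> x; have Hf := lavg_close x t0 Hs; have Hg := Ht x.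
rewrite lavgD -!lavg_lavg; move: Hf Hg.
rewrite !ler_norml => /andP[f1 f2] /andP[g1 g2].
by apply/andP; split; lra.
Qed.

Lemma mean_const (c : R) : mean (cst c) = c.
Proof.
apply: mean_unique; first exact: cst_continuous.
move=> e e0; exists [:: 1%g] => // x.
by rewrite /lavg avg_const // subrr normr0 ltW.
Qed.

Lemma meanZ (k : R) f : continuous f -> mean (fun x => k * f x) = k * mean f.
Proof.
move=> cf; apply: mean_unique.
  by move=> x; apply: cvgM; [exact: cvg_cst|exact: cf].
move=> e e0; have e1 : 0 < e / (`|k| + 1).
  by rewrite divr_gt0 // ltr_wpDl.
have [s s0 Hs] := meanP cf e1; exists s => // x.
rewrite lavgZ -mulrBr normrM.
apply: (@le_trans _ _ (`|k| * (e / (`|k| + 1)))); first exact: ler_wpM2l.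
rewrite mulrCA; apply: ler_piMr; first exact: ltW.
by rewrite ler_pdivrMr ?ltr_wpDl // mul1r lerDl.
Qed.

Lemma mean_norm_le f K : continuous f -> (forall x, `|f x| <= K) ->
  `|mean f| <= K.
Proof.
move=> cf fK; apply/ler_addgt0Pr => e e0.
have [s s0 Hs] := meanP cf e0.
have := Hs 1%g; rewrite distrC => Hm.
rewrite -[mean f](subrK (lavg s f 1%g)) addrC (le_trans (ler_normD _ _)) //.
by rewrite lerD //; exact: avg_norm_le.
Qed.

Lemma mean_sum n (f : 'I_n -> G -> R) : (forall i, continuous (f i)) ->
  mean (fun x => \sum_i f i x) = \sum_i mean (f i).
Proof.
elim: n f => [|n IH] f cf.
  by under eq_fun do rewrite big_ord0; rewrite big_ord0 mean_const.
under eq_fun do rewrite big_ord_recl; rewrite big_ord_recl -IH // -meanD //.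
move=> x; apply: cvg_big => [|i _]; first exact: add_continuous.
exact: cf.
Qed.

Lemma mean_mulgr f b : continuous f -> mean (fun x => f (x * b)%g) = mean f.
Proof.
move=> cf; apply: mean_unique => [|e e0].
  move=> x; apply: (@continuous_comp _ _ _ (fun x => (x * b)%g) f).
    by apply: continuous_mulg2 => y; [exact: cvg_id|exact: cvg_cst].
  exact: cf.
have [s s0 Hs] := meanP cf e0; exists s => // x.
have := Hs (x * b)%g; rewrite /lavg.
suff -> : \sum_(a <- s) f (a * (x * b))%g = \sum_(a <- s) f (a * x * b)%g by [].
by apply: eq_bigr => a _; rewrite mulgA.
Qed.

Lemma mean_mulgl f b : continuous f -> mean (fun x => f (b * x)%g) = mean f.
Proof.
move=> cf; apply: mean_unique => [|e e0].
  move=> x; apply: (@continuous_comp _ _ _ (fun x => (b * x)%g) f).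
    by apply: continuous_mulg2 => y; [exact: cvg_cst|exact: cvg_id].
  exact: cf.
have [s s0 Hs] := meanP cf e0.
exists [seq (b^-1 * a)%g | a <- s]; first by rewrite -size_eq0 size_map size_eq0.
move=> x; have := Hs x; rewrite /lavg size_map big_map.
suff -> : \sum_(a <- s) f (b * (b^-1 * a * x))%g = \sum_(a <- s) f (a * x)%g by [].
by apply: eq_bigr => a _; rewrite !mulgA mulgV mul1g.
Qed.

End Averages.

(** * Differentiation under the mean *)

Section MeanValue.
Variable R : realType.

Lemma mvt_directional (V : normedModType R) (f : V -> R) (x v : V) :
  (forall s : R, 0 <= s <= 1 -> differentiable f (s *: v + x)) ->
  exists2 s, 0 <= s <= 1 & f (v + x) - f x = 'D_v f (s *: v + x).
Proof.
move=> df; pose g (s : R) := f (s *: v + x).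
have dg (s : R) : 0 <= s <= 1 -> is_derive s (1 : R) g ('D_v f (s *: v + x)).
  move=> s01; have dfs := df _ s01.
  have da : is_diff s (fun s : R => s *: v + x) (fun h => h *: v).
    have -> : (fun s : R => s *: v + x) = ( *:%R^~ v : R -> V) + cst x by [].
    by apply: is_diff_eq; apply/funext => h; rewrite /= addr0.
  have dfs' : differentiable f ((fun s : R => s *: v + x) s) by [].
  have dgs : differentiable g s.
    exact: (differentiable_comp (@ex_diff _ _ _ _ _ _ _ da) dfs').
  apply: DeriveDef; first exact: diff_derivable.
  rewrite deriveE // /g (diff_comp (@ex_diff _ _ _ _ _ _ _ da) dfs') /=.
  by rewrite diff_val scale1r deriveE.
have [||s s01 E] := @MVT_segment R g (fun s => 'D_v f (s *: v + x)) 0 1 ler01.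
- by move=> s; rewrite in_itv /= => /andP[s0 s1]; apply: dg; rewrite !ltW.
- apply/continuous_in_subspaceT => s; rewrite inE /= in_itv /= => s01.
  by apply: differentiable_continuous; apply/derivable1_diffP; case: (dg s s01).
exists s; first by move: s01; rewrite in_itv.
by move: E; rewrite /g scale1r scale0r add0r subr0 mulr1.
Qed.

Lemma coord_bound (V : normedModType R) n (c : 'I_n -> {linear V -> R}) :
  (forall i, continuous (c i)) ->
  exists2 K, 0 < K & forall v, \sum_i `|c i v| <= K * `|v|.
Proof.
move=> cc; have H i := linear_lipschitz (cc i).
have [K HK] : exists K : 'I_n -> R,
    forall i, 0 < K i /\ forall v, `|c i v| <= K i * `|v|.
  have [K HK] := choice (fun i => let: ex_intro2 k k0 Hk := H i in
    ex_intro (fun k => 0 < k /\ forall v, `|c i v| <= k * `|v|) k (conj k0 Hk)).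
  by exists K.
exists (1 + \sum_i K i).
  by rewrite ltr_pwDl // sumr_ge0 // => i _; rewrite ltW //; case: (HK i).
move=> v; rewrite mulrDl mulr_suml ler_wpDl ?mul1r //.
by apply: ler_sum => i _; case: (HK i).
Qed.

Lemma fin_dim_linear_continuous (V W : normedModType R) (A : {linear V -> W}) :
  fin_dim V -> continuous A.
Proof.
move=> [n [e [c [cc ce]]]].
have -> : (A : V -> W) = (fun v => \sum_i c i v *: A (e i)).
  apply/funext => v; rewrite {1}(ce v) linear_sum; apply: eq_bigr => i _.
  by rewrite linearZ.
move=> v; apply: cvg_big => [|i _]; first exact: add_continuous.
by apply: cvgZr_tmp; exact: cc.
Qed.

Lemma derive_coord (V W : normedModType R) n (e : 'I_n -> V)
    (c : 'I_n -> {linear V -> R}) (f : V -> W) x v :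
  (forall v, v = \sum_i c i v *: e i) -> differentiable f x ->
  'D_v f x = \sum_i c i v *: 'D_(e i) f x.
Proof.
move=> ce df; rewrite deriveE // [in LHS](ce v) linear_sum.
by apply: eq_bigr => i _; rewrite linearZ /= deriveE.
Qed.

(** Transfers the closure properties of families to single maps; the parameter
    space is a dummy. *)
Lemma Ck_on_famP (V W : normedModType R) k (U : set V) (f : V -> W) :
  Ck_on k U f <-> Ck_fam k (setT `*` U) (fun p : R * V => f p.2).
Proof.
split=> [|H]; first exact: Ck_fam_snd.
have -> : U = [set x | (setT `*` U) (0 : R, x)].
  by apply/seteqP; split=> x //= [].
exact: (Ck_fam_slice 0 H).
Qed.

Lemma eq_Ck_on (V W : normedModType R) k (U : set V) (f g : V -> W) :
  open U -> (forall x, U x -> f x = g x) -> Ck_on k U f -> Ck_on k U g.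
Proof.
move=> oU fg /Ck_on_famP cf; apply/Ck_on_famP.
apply: eq_Ck_fam cf => [|p [_ Up]]; last exact: fg.
exact: open_setTX.
Qed.

End MeanValue.

Section MeanOfFamilies.
Variables (R : realType) (G : lieGroupType R) (V : normedModType R).
Hypothesis compactG : compact [set: G].
Hypothesis fdV : fin_dim V.

Lemma uniformly_close (W : normedModType R) (F : G * V -> W) x e : 0 < e ->
  (forall a, {for (a, x), continuous F}) ->
  \forall y \near x, forall a, `|F (a, y) - F (a, x)| <= e.
Proof.
move=> e0 cF; have e20 : 0 < e / 2 by rewrite divr_gt0.
apply: (tube_lemma compactG (O := fun p => `|F p - F (p.1, x)| <= e)) => a.
have H1 : \forall p \near (a, x), `|F (a, x) - F p| < e / 2.
  by have /cvgrPdist_lt := cF a; apply.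
have H2 : \forall p \near (a, x), `|F (a, x) - F (p.1, x)| < e / 2.
  have : {for (a, x), continuous (fun p : G * V => F (p.1, x))}.
    apply: (@continuous_comp _ _ _ (fun p : G * V => (p.1, x)) F).
      by apply: cvg_pair; [exact: cvg_fst|exact: cvg_cst].
    exact: cF.
  by move=> /cvgrPdist_lt; apply.
apply: filterS2 H1 H2 => p h1 h2.
rewrite -(subrK (F (a, x)) (F p)) -addrA (le_trans (ler_normD _ _)) //.
by rewrite (splitr e) lerD // ltW // distrC.
Qed.

Variables (U : set V) (oU : open U).

Lemma fam_slice_continuous (W : normedModType R) k (F : G * V -> W) x :
  Ck_fam k (setT `*` U) F -> U x -> continuous (fun a => F (a, x)).
Proof.
move=> cF Ux a; apply: (@continuous_comp _ _ _ (fun a => (a, x)) F).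
  by apply: cvg_pair; [exact: cvg_id|exact: cvg_cst].
exact: (Ck_fam_continuous cF).
Qed.

Lemma mean_continuous_at (F : G * V -> R) x :
  Ck_fam 0 (setT `*` U) F -> U x ->
  {for x, continuous (fun x => mean (fun a => F (a, x)))}.
Proof.
move=> cF Ux; apply/cvgrPdist_le => e e0.
have nU : nbhs x U by exact: open_nbhs_nbhs.
have nF := uniformly_close e0 (fun a => (Ck_fam_continuous cF) (a, x) (conj I Ux)).
apply: filterS2 nU nF => y Uy Fy.
have -> : mean (fun a => F (a, x)) - mean (fun a => F (a, y)) =
    mean (fun a => F (a, x) + -1 * F (a, y)).
  have cx := fam_slice_continuous cF Ux; have cy := fam_slice_continuous cF Uy.
  rewrite (@meanD _ _ compactG (fun a => F (a, x)) (fun a => -1 * F (a, y))) //.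
    by rewrite meanZ // mulN1r.
  by move=> a; apply: cvgM; [exact: cvg_cst|exact: cy].
apply: mean_norm_le => // [a|a].
  apply: cvgD; first exact: (fam_slice_continuous cF Ux).
  by apply: cvgM; [exact: cvg_cst|exact: (fam_slice_continuous cF Uy)].
by rewrite mulN1r distrC.
Qed.

(** By the mean value theorem the remainder of order one of [F (a, _)] is
    controlled by the variation of its partial derivatives near [x], and
    compactness makes this variation small uniformly in [a]. *)
Lemma mean_differentiable (F : G * V -> R) x :
  Ck_fam 1 (setT `*` U) F -> U x ->
  differentiable (fun x => mean (fun a => F (a, x))) x /\
  forall v, 'D_v (fun x => mean (fun a => F (a, x))) x =
    mean (fun a => 'D_v (fun x => F (a, x)) x).
Proof.
move=> cF Ux; have [cF0 [dF DF]] := cF.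
have dFx a : differentiable (fun x => F (a, x)) x by exact: (dF (a, x)).
have cD v : continuous (fun a => 'D_v (fun x => F (a, x)) x).
  exact: (@fam_slice_continuous _ 0
    (fun p => 'D_v (fun x => F (p.1, x)) p.2) _ (DF v) Ux).
pose A v := mean (fun a => 'D_v (fun x => F (a, x)) x).
have linA : linear A.
  move=> k u v; rewrite /A -[k *: mean _]/(k * mean _) -meanZ // -meanD //; last first.
    by move=> a; apply: cvgM; [exact: cvg_cst|exact: cD].
  by congr mean; apply/funext => a /=; rewrite !deriveE // linearP.
pose AM := GRing.isLinear.Build _ _ _ _ _ linA.
pose AL : {linear V -> R} := HB.pack A AM.
have [n [e [c [cc ce]]]] := fdV.
have [K K0 cK] := coord_bound cc.
suff [H1 H2] : differentiable (fun x => mean (fun a => F (a, x))) x /\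
    'd (fun x => mean (fun a => F (a, x))) x = AL :> (V -> R).
  by split=> // v; rewrite deriveE // H2.
apply: differentiable_boundP; first exact: fin_dim_linear_continuous.
move=> eps eps0; have epsK : 0 < eps / K by rewrite divr_gt0.
have nU : nbhs x U by exact: open_nbhs_nbhs.
have nD : \forall y \near x, forall i a,
    `|'D_(e i) (fun x => F (a, x)) y - 'D_(e i) (fun x => F (a, x)) x| <= eps / K.
  apply: filter_forall => i.
  apply: (uniformly_close (F := fun p => 'D_(e i) (fun x => F (p.1, x)) p.2)) => //.
  by move=> a; apply: (@Ck_fam_continuous _ _ _ _ 0 _ _ (DF (e i))).
have [r /= r0 Hr] := (nbhs_ballP _ _).1 (filterI nU nD).
have nr : \forall v \near (0 : V), `|v| < r.
  exact: nbhs0_lt.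
apply: filterS nr => v vr.
have seg s : 0 <= s <= 1 -> ball x r (s *: v + x).
  move=> /andP[s0 s1]; rewrite -ball_normE /= opprD addrCA subrr addr0 normrN.
  rewrite normrZ ger0_norm // (le_lt_trans _ vr) // ler_piMl //.
have Uv : U (v + x).
  by have [] := Hr _ (seg 1 (introT andP (conj ler01 (lexx _)))); rewrite scale1r.
have bnd a : `|F (a, v + x) - F (a, x) - 'D_v (fun x => F (a, x)) x| <= eps * `|v|.
  have [|s s01 ->] := @mvt_directional _ _ (fun x => F (a, x)) x v.
    by move=> s s01; have [Us _] := Hr _ (seg s s01); exact: (dF (a, _)).
  have [Us Hs] := Hr _ (seg s s01).
  rewrite !(derive_coord _ ce) //; last exact: (dF (a, _)).
  rewrite -sumrB (le_trans (ler_norm_sum _ _ _)) //.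
  apply: (@le_trans _ _ (\sum_i `|c i v| * (eps / K))).
    by apply: ler_sum => i _; rewrite -scalerBr normrZ ler_wpM2l.
  rewrite -mulr_suml (le_trans (ler_wpM2r (ltW epsK) (cK v))) //.
  by rewrite mulrAC [K * (eps / K)]mulrC divfK // gt_eqF.
have cv := fam_slice_continuous cF Uv; have cx := fam_slice_continuous cF Ux.
have -> : mean (fun a => F (a, v + x)) - mean (fun a => F (a, x)) - AL v =
   mean (fun a => F (a, v + x) + -1 * F (a, x) + -1 * 'D_v (fun x => F (a, x)) x).
  have c1 : continuous (fun a => -1 * F (a, x)).
    by move=> a; apply: cvgM; [exact: cvg_cst|exact: cx].
  have c2 : continuous (fun a => -1 * 'D_v (fun x => F (a, x)) x).
    by move=> a; apply: cvgM; [exact: cvg_cst|exact: cD].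
  have c3 : continuous (fun a => F (a, v + x) + -1 * F (a, x)).
    by move=> a; apply: cvgD; [exact: cv|exact: c1].
  rewrite (meanD compactG c3 c2) (meanD compactG cv c1) !meanZ // !mulN1r.
  by [].
apply: mean_norm_le => //; last by move=> a; rewrite !mulN1r.
move=> a; apply: cvgD; last by apply: cvgM; [exact: cvg_cst|exact: cD].
by apply: cvgD; [exact: cv|apply: cvgM; [exact: cvg_cst|exact: cx]].
Qed.

Lemma Ck_mean k (F : G * V -> R) : Ck_fam k (setT `*` U) F ->
  Ck_on k U (fun x => mean (fun a => F (a, x))).
Proof.
elim: k F => [|k IH] F cF; first by move=> x Ux; exact: mean_continuous_at cF Ux.
have cF1 : Ck_fam 1 (setT `*` U) F.
  by elim: k {IH} cF => // k IH /Ck_famW.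
split=> [x Ux|v]; first by have [] := mean_differentiable cF1 Ux.
have [_ [_ DF]] := cF.
apply: eq_Ck_on (IH _ (DF v)) => // x Ux.
by have [_ ->] := mean_differentiable cF1 Ux.
Qed.

End MeanOfFamilies.

(** * Fixed points and linear systems in finite dimension *)

Section ContractionPrinciple.
Variables (R : realType) (V : normedModType R).
Hypothesis fdV : fin_dim V.

Lemma fin_dim_complete (F : set_system V) : ProperFilter F -> cauchy F -> cvg F.
Proof.
move=> FF cF; have [n [e [c [cc ce]]]] := fdV.
have cvgc i : cvg (c i @ F).
  apply: R_complete; apply/cauchyP => eps eps0.
  have [K K0 cK] := linear_lipschitz (cc i).
  have [|x Fx] := (cauchyP F).1 cF (eps / K); first by rewrite divr_gt0.
  exists (c i x); have : F [set y | ball (c i x) eps (c i y)] by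
    apply: filterS Fx => y; rewrite -!ball_normE /= => xy;
    rewrite -(linearB (c i)); apply: le_lt_trans (cK _) _;
    rewrite mulrC -ltr_pdivlMr.
  by [].
apply/cvg_ex; exists (\sum_i lim (c i @ F) *: e i).
have : (fun v => \sum_i c i v *: e i) @ F --> \sum_i lim (c i @ F) *: e i.
  apply: cvg_big => [|i _]; first exact: add_continuous.
  by apply: cvgZr_tmp; exact: cvgc.
by under eq_fun do rewrite -ce.
Qed.

(** The factor 1/2 is the one obtained for maps whose derivative is close
    to that of the identity. *)
Lemma contraction_fixpoint (D : set V) (g : V -> V) (x0 : V) :
  closed D -> D x0 -> (forall x, D x -> D (g x)) ->
  (forall x y, D x -> D y -> `|g x - g y| <= 2^-1 * `|x - y|) ->
  exists2 x, D x & g x = x.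
Proof.
move=> clD Dx0 Dg gl.
(* [fin_dim_complete] provides the structure on which [banach_fixed_point] is
   stated. *)
pose VC : completeNormedModType R :=
  HB.pack V (Uniform_isComplete.Build V fin_dim_complete).
pose gM := isFun.Build _ _ (D : set VC) (D : set VC) (g : VC -> VC) Dg.
pose gF : {fun (D : set VC) >-> (D : set VC)} := HB.pack (g : VC -> VC) gM.
have ctr : is_contraction gF.
  exists (2^-1)%:nng; split; first by rewrite /= invf_lt1 ?ltr1n.
  by move=> [x y] [/= Dx Dy]; exact: gl.
have [//||p Dp gp] := banach_fixed_point ctr _ _; first by exists x0.
by exists p.
Qed.

End ContractionPrinciple.

Section CkOnOperations.
Variables (R : realType).
Implicit Types V W X : normedModType R.

Lemma Ck_on_cst V W k (U : set V) (w : W) : Ck_on k U (fun=> w).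
Proof.
apply/Ck_on_famP; apply: (@Ck_fam_param _ _ _ _ _ _ (fun=> w)) => p _.
exact: cst_continuous.
Qed.

Lemma Ck_onW V W k (U : set V) (f : V -> W) : Ck_on k.+1 U f -> Ck_on k U f.
Proof. by move=> /Ck_on_famP cf; apply/Ck_on_famP; exact: Ck_famW. Qed.

Lemma Ck_on_continuous V W k (U : set V) (f : V -> W) x :
  Ck_on k U f -> U x -> {for x, continuous f}.
Proof.
case: k => [|k] H Ux; first exact: H.
by apply: differentiable_continuous; case: H => df _; exact: df.
Qed.

Lemma Ck_onD V W k (U : set V) (f g : V -> W) : open U ->
  Ck_on k U f -> Ck_on k U g -> Ck_on k U (f \+ g).
Proof.
move=> oU /Ck_on_famP cf /Ck_on_famP cg; apply/Ck_on_famP.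
by apply: Ck_famD => //; exact: open_setTX.
Qed.

Lemma Ck_on_sum V W k (U : set V) n (f : 'I_n -> V -> W) : open U ->
  (forall i, Ck_on k U (f i)) -> Ck_on k U (fun x => \sum_i f i x).
Proof.
move=> oU cf; apply/Ck_on_famP.
apply: (@Ck_fam_sum _ _ _ _ _ _ _ (fun i p => f i p.2)) => [|i].
  exact: open_setTX.
by apply/Ck_on_famP.
Qed.

Lemma Ck_onZ V W k (U : set V) (r : V -> R) (f : V -> W) : fin_dim W ->
  open U -> Ck_on k U r -> Ck_on k U f -> Ck_on k U (fun x => r x *: f x).
Proof.
move=> fW oU /Ck_on_famP cr /Ck_on_famP cf; apply/Ck_on_famP.
by apply: (Ck_famZ (F := fun p => f p.2)) => //; exact: open_setTX.
Qed.

Lemma Ck_on_linear V W X k (U : set V) (f : V -> W) (L : {linear W -> X}) :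
  open U -> continuous L -> Ck_on k U f -> Ck_on k U (L \o f).
Proof.
move=> oU cL /Ck_on_famP cf; apply/Ck_on_famP.
by apply: (Ck_fam_linear (F := fun p => f p.2)) => //; exact: open_setTX.
Qed.

Lemma Ck_on_comp V W X k (U : set V) (U' : set W) (f : V -> W) (g : W -> X) :
  fin_dim W -> fin_dim X -> open U -> (forall x, U x -> U' (f x)) ->
  Ck_on k U f -> Ck_on k U' g -> Ck_on k U (g \o f).
Proof.
move=> fW fX oU fU /Ck_on_famP cf cg; apply/Ck_on_famP.
apply: (Ck_fam_comp (F := fun p => f p.2) (U := U') fW fX) => //.
  exact: open_setTX.
by move=> p [_ Up]; exact: fU.
Qed.

Lemma Ck_on_curve W k (I : set R) (u : R -> W) : open I -> fin_dim W ->
  (forall t, I t -> differentiable u t) -> Ck_on k I ('D_1 u) ->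
  Ck_on k.+1 I u.
Proof.
move=> oI fW du cu; split=> // v.
have cv : Ck_on k I (fun=> v : R) by exact: Ck_on_cst.
apply: (eq_Ck_on oI _ (Ck_onZ fW oI cv cu)) => t It.
have dut := du _ It; rewrite !deriveE //.
by rewrite -[in RHS](mulr1 v) -[v * 1]/(v *: (1 : R)) linearZ.
Qed.

End CkOnOperations.

Section LinearSystem.
Variables (R : realType) (E : normedModType R).
Variables (n : nat) (e : 'I_n -> E) (c : 'I_n -> {linear E -> R}).
Hypothesis cc : forall i, continuous (c i).
Hypothesis ce : forall v, v = \sum_i c i v *: e i.
Variables (I : set R) (oI : open I).

Let fE : fin_dim E. Proof. by exists n, e, c. Qed.

(** The matrix with columns [A i t], applied to [v]. *)
Definition lincomb (A : 'I_n -> R -> E) (t : R) (v : E) : E :=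
  \sum_i c i v *: A i t.

Lemma lincombB A t u v : lincomb A t (u - v) = lincomb A t u - lincomb A t v.
Proof.
by rewrite /lincomb -sumrB; apply: eq_bigr => i _; rewrite linearB scalerBl.
Qed.

Lemma lincombZ A t k v : lincomb A t (k *: v) = k *: lincomb A t v.
Proof.
by rewrite /lincomb scaler_sumr; apply: eq_bigr => i _; rewrite linearZ scalerA.
Qed.

Lemma Ck_on_lincomb k A u : (forall i, Ck_on k I (A i)) -> Ck_on k I u ->
  Ck_on k I (fun t => lincomb A t (u t)).
Proof.
move=> cA cu; apply: (@Ck_on_sum _ _ _ k I n (fun i t => c i (u t) *: A i t)) => // i.
apply: Ck_onZ => //; exact: Ck_on_linear.
Qed.

Lemma lincomb_solution_continuous A w u t : I t ->
  (forall t v, I t -> `|v| <= 2 * `|lincomb A t v|) ->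
  (forall i, Ck_on 0 I (A i)) -> Ck_on 0 I w ->
  (forall t, I t -> lincomb A t (u t) = w t) -> {for t, continuous u}.
Proof.
move=> It bA cA cw Au.
have c0 : Ck_on 0 I (fun s => lincomb A s (u t)).
  by apply: Ck_on_lincomb => //; exact: Ck_on_cst.
have ct : 2 * `|w s - lincomb A s (u t)| @[s --> t] -->
    2 * `|w t - lincomb A t (u t)|.
  apply: cvgM; first exact: cvg_cst.
  by apply: cvg_norm; apply: cvgB; [exact: cw|exact: c0].
rewrite Au // subrr normr0 mulr0 in ct.
apply/cvgrPdist_lt => eps eps0.
have nI : nbhs t I by exact: open_nbhs_nbhs.
move/cvgr0Pnorm_lt : ct => /(_ _ eps0); apply: filterS2 nI => s Is H.
rewrite distrC (le_lt_trans (bA s _ Is)) // lincombB Au //.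
exact: le_lt_trans (ler_norm _) H.
Qed.

(** Differentiating [A u = w] formally gives [A u' = w' - A' u]. A solution [d]
    of this equation is the derivative of [u], because [A] applied to the
    remainder [u (t + h) - u t - h d] is negligible and [A] is bounded below. *)
Lemma lincomb_solution_differentiable A w u t : I t ->
  (forall t v, I t -> `|v| <= 2 * `|lincomb A t v|) ->
  (forall t b, I t -> exists v, lincomb A t v = b) ->
  (forall i, Ck_on 1 I (A i)) -> Ck_on 1 I w ->
  (forall t, I t -> lincomb A t (u t) = w t) ->
  differentiable u t /\
  lincomb A t ('D_1 u t) = 'D_1 w t - lincomb (fun i => 'D_1 (A i)) t (u t).
Proof.
move=> It bA sA cA cw Au.
have dA i : differentiable (A i) t by case: (cA i) => dA _; exact: dA.
have dw : differentiable w t by case: cw => dw _; exact: dw.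
set b := _ - _; have bE : b = 'D_1 w t - lincomb (fun i => 'D_1 (A i)) t (u t) by [].
clearbody b; have [d Ad] := sA t b It.
have linL : linear (fun h : R => h *: d).
  by move=> k x y; rewrite scalerDl scalerA.
pose LM := GRing.isLinear.Build _ _ _ _ _ linL.
pose L : {linear R -> E} := HB.pack (fun h : R => h *: d) LM.
have cL : continuous L by move=> x; apply: cvgZr_tmp; exact: cvg_id.
pose phi s := w s - lincomb A s (u t).
have dsys v : differentiable (fun s => lincomb A s v) t /\
    'D_1 (fun s => lincomb A s v) t = lincomb (fun i => 'D_1 (A i)) t v.
  have -> : (fun s => lincomb A s v) = \sum_i (c i v \*: A i).
    by apply/funext => s; rewrite fct_sumE.
  split; first by apply: differentiable_sum => i; exact: differentiableZ.
  rewrite derive_sum => [|i]; last exact/diff_derivable/differentiableZ.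
  by apply: eq_bigr => i _; rewrite deriveZ //; exact: diff_derivable.
have [ds Ds] := dsys (u t).
have dphi : differentiable phi t by exact: differentiableB.
have phit : phi t = 0 by rewrite /phi Au // subrr.
have Dphi h : 'd phi t h = h *: b.
  rewrite -[h in LHS]mulr1 -[h * 1]/(h *: (1 : R)) linearZ /= -deriveE //.
  by rewrite deriveB ?Ds ?bE //; exact: diff_derivable.
have [|du Lu] := @differentiable_boundP R _ _ u t L cL; last first.
  by split=> //; rewrite deriveE // Lu /= scale1r.
move=> eps eps0; have e40 : 0 < eps / 4 by rewrite divr_gt0.
have cvt : (fun h : R => h + t) @ (0 : R) --> t.
  have : (fun h : R => h + t) @ (0 : R) --> 0 + t.
    by apply: cvgD; [exact: cvg_id|exact: cvg_cst].
  by rewrite add0r.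
have nI : \forall h \near (0 : R), I (h + t).
  by apply: (cvt I); exact: open_nbhs_nbhs.
have nphi := differentiable_bound dphi e40.
have nA : \forall h \near (0 : R), `|lincomb A (h + t) d - b| < eps / 4.
  have H : lincomb A (h + t) d @[h --> (0 : R)] --> lincomb A t d.
    have [dsd _] := dsys d.
    apply: (@cvg_comp _ _ _ (fun h : R => h + t) (fun s => lincomb A s d) _ (nbhs t)).
      exact: cvt.
    exact: (differentiable_continuous dsd).
  rewrite Ad in H; move/cvgrPdist_lt : H => /(_ _ e40).
  by apply: filterS => h; rewrite distrC.
near=> h.
have Ih : I (h + t) by near: h.
rewrite (le_trans (bA _ _ Ih)) // /L /= !lincombB lincombZ Au //.
(* The remainder of [u], seen through [A], is the remainder of [phi] up to the
   variation of the matrix between [t] and [h + t]. *)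
have -> : w (h + t) - lincomb A (h + t) (u t) - h *: lincomb A (h + t) d =
   (phi (h + t) - phi t - 'd phi t h) - h *: (lincomb A (h + t) d - b).
  by rewrite phit subr0 Dphi scalerBr opprB addrA subrK.
have h1 : `|phi (h + t) - phi t - 'd phi t h| <= eps / 4 * `|h|.
  by near: h.
have h2 : `|h *: (lincomb A (h + t) d - b)| <= eps / 4 * `|h|.
  by rewrite normrZ mulrC ler_wpM2r // ltW //; near: h.
have := ler_normB (phi (h + t) - phi t - 'd phi t h) (h *: (lincomb A (h + t) d - b)).
lra.
Unshelve. all: by end_near. Qed.

(** The derivative of the solution solves a system with the same matrix and
    the right-hand side [w' - A' u], so regularity improves one order at a
    time. *)
Lemma Ck_lincomb_solution k A w u :
  (forall t v, I t -> `|v| <= 2 * `|lincomb A t v|) ->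
  (forall t b, I t -> exists v, lincomb A t v = b) ->
  (forall i, Ck_on k I (A i)) -> Ck_on k I w ->
  (forall t, I t -> lincomb A t (u t) = w t) -> Ck_on k I u.
Proof.
move=> bA sA; elim: k w u => [|k IH] w u cA cw Au.
  by move=> t It; exact: (lincomb_solution_continuous It bA cA cw Au).
have W1 (f : R -> E) : Ck_on k.+1 I f -> Ck_on 1 I f.
  by elim: k {IH cA cw} f => // k IH f /Ck_onW; exact: IH.
have cA' i : Ck_on k I (A i) by exact: Ck_onW.
have cu : Ck_on k I u by apply: IH Au => //; exact: Ck_onW.
have H t (It : I t) := lincomb_solution_differentiable It bA sA
  (fun i => W1 _ (cA i)) (W1 _ cw) Au.
apply: Ck_on_curve => // [t It|]; first by have [] := H t It.
apply: (IH (fun t => 'D_1 w t - lincomb (fun i => 'D_1 (A i)) t (u t))) => //; last first.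
  by move=> t It; have [_ ->] := H t It.
have cm : Ck_on k I (fun t => (-1 : R) *: lincomb (fun i => 'D_1 (A i)) t (u t)).
  apply: Ck_onZ => //; first exact: Ck_on_cst.
  by apply: Ck_on_lincomb => // i; case: (cA i) => _; exact.
have cw' : Ck_on k I ('D_1 w) by case: cw => _; exact.
apply: eq_Ck_on oI _ (Ck_onD oI cw' cm) => t It /=.
by rewrite scaleN1r.
Qed.

End LinearSystem.

(** * Inverting a map tangent to the identity along a line *)

Section LocalInverse.
Variables (R : realType) (E : normedModType R).
Hypothesis fE : fin_dim E.

(** The constant [C] pays for the passage from the coordinates, where the mean
    value theorem applies, to the norm. *)
Lemma mean_value_inequality (V : normedModType R) : exists2 C : R, 0 < C &
  forall (h : V -> E) x v k,
    (forall s : R, 0 <= s <= 1 -> differentiable h (s *: v + x) /\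
       `|'D_v h (s *: v + x)| <= k) ->
    `|h (v + x) - h x| <= C * k.
Proof.
have [n [e [c [cc ce]]]] := fE; have [K K0 cK] := coord_bound cc.
pose C := K * \sum_i `|e i|.
exists (C + 1).
  by rewrite ltr_wpDl // mulr_ge0 // ?sumr_ge0 // ltW.
move=> h x v k Hh.
have k0 : 0 <= k.
  have [|_] := Hh 0; first by rewrite lexx ler01.
  exact: le_trans (normr_ge0 _).
suff : `|h (v + x) - h x| <= C * k.
  by rewrite mulrDl => /le_trans; apply; rewrite lerDl mul1r.
rewrite [X in `|X|](ce (h (v + x) - h x)) (le_trans (ler_norm_sum _ _ _)) //.
rewrite /C mulr_sumr mulr_suml; apply: ler_sum => i _.
rewrite normrZ mulrAC ler_wpM2r // linearB.
have [|s s01 ->] := @mvt_directional R V (c i \o h) x v.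
  move=> s s01; have [dh _] := Hh s s01.
  by apply: differentiable_comp => //; exact: linear_differentiable.
have [dh bh] := Hh s s01.
have dc : differentiable (c i) (h (s *: v + x)) by exact: linear_differentiable.
rewrite (deriveE _ (differentiable_comp dh dc)) diff_comp //= diff_lin //.
rewrite -deriveE //.
have H : `|c i ('D_v h (s *: v + x))| <= K * `|'D_v h (s *: v + x)|.
  by apply: le_trans (cK _); rewrite (bigD1 i) //= lerDl sumr_ge0.
by apply: le_trans H _; rewrite ler_pM2l.
Qed.

Variables (U : set E) (oU : open U) (p0 : E) (Up0 : U p0) (f : E -> E).
Hypothesis cf : Ck_on 1 U f.
Hypothesis f'p0 : forall v, 'D_v f p0 = v.

(** Near [p0] the derivative of [f - id] is small, hence [f - id] is a
    contraction there. *)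
Lemma near_identity : exists2 r, 0 < r &
  (forall x, `|x - p0| <= r ->
     U x /\ forall v, `|'D_v f x - v| <= 2^-1 * `|v|) /\
  (forall x y, `|x - p0| <= r -> `|y - p0| <= r ->
     `|(f x - x) - (f y - y)| <= 2^-1 * `|x - y|).
Proof.
have [n [e [c [cc ce]]]] := fE; have [K K0 cK] := coord_bound cc.
have [C C0 mvi] := mean_value_inequality E.
have [df Df] := cf.
pose k := 2^-1 / (1 + C).
have C1 : 0 < 1 + C by rewrite ltr_wpDl.
have k0 : 0 < k by rewrite divr_gt0.
have kK : 0 < k / K by rewrite divr_gt0.
have nU : nbhs p0 U by exact: open_nbhs_nbhs.
have nD : \forall x \near p0, forall j, `|'D_(e j) f x - e j| < k / K.
  apply: filter_forall => j.
  have : {for p0, continuous ('D_(e j) f)} by exact: Df.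
  rewrite /prop_for /continuous_at f'p0 => /cvgrPdist_lt /(_ _ kK).
  by apply: filterS => x; rewrite distrC.
have [r /= r0 Hr] := (nbhs_ballP _ _).1 (filterI nU nD).
exists (r / 2); first by rewrite divr_gt0.
have inr x : `|x - p0| <= r / 2 -> ball p0 r x.
  move=> xr; rewrite -ball_normE /= distrC (le_lt_trans xr) //.
  by rewrite ltr_pdivrMr // ltr_pMr // ltr1n.
have Dbnd x : `|x - p0| <= r / 2 -> U x /\ forall v, `|'D_v f x - v| <= k * `|v|.
  move=> /inr/Hr [Ux Dx]; split=> // v.
  have dfx : differentiable f x by exact: df.
  have -> : 'D_v f x - v = \sum_i c i v *: ('D_(e i) f x - e i).
    under eq_bigr do rewrite scalerBr.
    by rewrite sumrB -(derive_coord _ ce) // -ce.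
  rewrite (le_trans (ler_norm_sum _ _ _)) //.
  apply: (@le_trans _ _ (\sum_i `|c i v| * (k / K))).
    by apply: ler_sum => i _; rewrite normrZ ler_wpM2l // ltW.
  rewrite -mulr_suml (le_trans (ler_wpM2r (ltW kK) (cK v))) //.
  by rewrite mulrAC [K * (k / K)]mulrC divfK // gt_eqF.
have k2 : k <= 2^-1 by rewrite ler_pdivrMr // ler_peMr // lerDl ltW.
have Ck2 : C * k <= 2^-1.
  by rewrite /k mulrCA ler_piMr // ler_pdivrMr // mul1r lerDr.
split.
  move=> x /Dbnd [Ux Dx]; split=> // v; apply: le_trans (Dx v) _.
  exact: ler_wpM2r.
move=> x y xr yr; have := mvi (fun z => f z - z) y (x - y) (k * `|x - y|).
rewrite subrK => H.
apply: (@le_trans _ _ (C * (k * `|x - y|))); last by rewrite mulrA ler_wpM2r.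
apply: H => s /andP[s0 s1].
have sr : `|s *: (x - y) + y - p0| <= r / 2.
  have -> : s *: (x - y) + y - p0 = s *: (x - p0) + (1 - s) *: (y - p0).
    have -> : x - y = (x - p0) - (y - p0) by rewrite opprB addrA subrK.
    by rewrite scalerBr scalerBl scale1r -!addrA; congr (_ + _); rewrite addrC -!addrA.
  rewrite (le_trans (ler_normD _ _)) // !normrZ ger0_norm // ger0_norm ?subr_ge0 //.
  apply: (@le_trans _ _ (s * (r / 2) + (1 - s) * (r / 2))).
    by rewrite lerD // ler_wpM2l // subr_ge0.
  by rewrite -mulrDl addrC subrK mul1r.
have [Us Ds] := Dbnd _ sr.
have dfs := df _ Us; split; first exact: differentiableB.
have -> : 'D_(x - y) (fun z => f z - z) (s *: (x - y) + y) =
   'D_(x - y) f (s *: (x - y) + y) - (x - y).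
  by rewrite deriveB ?derive_id //; exact: diff_derivable.
exact: Ds.
Qed.

End LocalInverse.

Section InverseCurve.
Variables (R : realType) (E : normedModType R).
Hypothesis fE : fin_dim E.
Variables (U : set E) (oU : open U) (p0 : E) (Up0 : U p0) (f : E -> E).
Hypothesis cf : Cinfty_on U f.
Hypothesis fp0 : f p0 = p0.
Hypothesis f'p0 : forall v, 'D_v f p0 = v.
Variable w : E.

Lemma subr_subB (b x y : E) : b - x - (b - y) = y - x.
Proof. by rewrite opprD addrACA subrr add0r opprK addrC. Qed.

Lemma subr_subACA (a b u v : E) : a - v - (b - u) = (a - b) - (v - u).
Proof. by rewrite !opprD !opprK addrACA. Qed.

Lemma subr_fix (b x v : E) : b - (x - v) = v -> x = b.
Proof.
move=> /eqP; rewrite opprB addrCA -[X in _ == X]addr0 (inj_eq (addrI v)).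
by rewrite subr_eq0 => /eqP.
Qed.

Lemma near_identity_expand (g : E -> E) x y :
  `|(g x - x) - (g y - y)| <= 2^-1 * `|x - y| -> `|x - y| <= 2 * `|g x - g y|.
Proof.
move=> H; have E1 : x - y = (g x - g y) - ((g x - x) - (g y - y)).
  by rewrite opprB addrA subrKA opprB addrC subrKA.
have := ler_normB (g x - g y) ((g x - x) - (g y - y)); rewrite -E1; lra.
Qed.

(** Solving ['D_v f x = b] for [v] is a fixed point problem for the contraction
    [v |-> b - ('D_v f x - v)]. *)
Lemma derive_surjective x : differentiable f x ->
  (forall v, `|'D_v f x - v| <= 2^-1 * `|v|) ->
  forall b, exists v, 'D_v f x = b.
Proof.
move=> df H b; pose g v := b - ('D_v f x - v).
have [||||v _ gv] := contraction_fixpoint fE (D := setT) (g := g) (x0 := 0).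
- exact: closedT.
- by [].
- by [].
- move=> u v _ _; rewrite /g subr_subB.
  have -> : 'D_v f x - v - ('D_u f x - u) = 'D_(v - u) f x - (v - u).
    by rewrite !deriveE // (linearB ('d f x)); exact: subr_subACA.
  by rewrite -[u - v]opprB normrN; exact: H.
by exists v; exact: subr_fix gv.
Qed.

(** The points [y t] are found as fixed points of contractions. As [f] shrinks
    distances at most by half, [y] is Lipschitz; then it is differentiable with
    derivative the solution of ['D_(y' t) f (y t) = w], and this linear system
    raises its regularity from C^k to C^(k+1). *)
Theorem inverse_curve : exists (r eps : R) (y : R -> E),
  [/\ 0 < r, 0 < eps,
     (forall x, `|x - p0| <= r -> U x),
     (forall x x', `|x - p0| <= r -> `|x' - p0| <= r -> f x = f x' -> x = x') &
   [/\ y 0 = p0, Cinfty_on (`]- eps, eps[%classic : set R) y &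
     forall t, - eps < t < eps -> `|y t - p0| <= r /\ f (y t) = p0 + t *: w]].
Proof.
have [r r0 [Dr Lr]] := near_identity fE oU Up0 (cf 1) f'p0.
have [n [e [c [cc ce]]]] := fE.
have inj x x' : `|x - p0| <= r -> `|x' - p0| <= r -> f x = f x' -> x = x'.
  move=> xr x'r fx; have := near_identity_expand (Lr _ _ xr x'r).
  by rewrite fx subrr normr0 mulr0 normr_le0 subr_eq0 => /eqP.
have w1 : 0 < `|w| + 1 by rewrite ltr_wpDl.
(* For [|t| < eps] the displacement [t *: w] has norm at most [r / 2], the
   other half of [r] being used by the contraction. *)
pose eps := r / 2 / (`|w| + 1).
have eps0 : 0 < eps by rewrite !divr_gt0.
have tw t : - eps < t < eps -> `|t *: w| <= r / 2.
  rewrite -ltr_norml => teps; rewrite normrZ.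
  apply: (@le_trans _ _ (eps * (`|w| + 1))); last by rewrite divfK // gt_eqF.
  by apply: ler_pM => //; [exact: ltW|rewrite lerDl].
pose P t := [set x | `|x - p0| <= r /\ f x = p0 + t *: w].
have exP t : - eps < t < eps -> exists x, P t x.
  move=> /tw tr; pose g x := p0 + t *: w - (f x - x).
  have [||||x xr gx] := contraction_fixpoint fE (D := [set x | `|x - p0| <= r])
     (g := g) (x0 := p0).
  - apply: (@closed_comp _ _ (fun x => `|x - p0|) [set s | s <= r]).
      by move=> x _; apply: cvg_norm; apply: cvgB; [exact: cvg_id|exact: cvg_cst].
    exact: closed_le.
  - by rewrite /= subrr normr0 ltW.
  - move=> x xr /=; have := Lr x p0 xr; rewrite subrr normr0 fp0 subrr subr0.
    move=> /(_ (ltW r0)) H.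
    have -> : g x - p0 = t *: w - (f x - x).
      by rewrite /g addrAC [p0 + _]addrC addrK.
    have := ler_normB (t *: w) (f x - x); move: xr; rewrite /=; lra.
  - move=> x x' xr x'r; rewrite /g subr_subB.
    by rewrite -normrN opprB; exact: Lr.
  by exists x; split=> //; exact: subr_fix gx.
(* The default value [p0] is never taken for [|t| < eps]. *)
pose y t := xget p0 (P t).
have yP t : - eps < t < eps -> P t (y t) by move=> /exP; exact: xgetPex.
have y0 : y 0 = p0.
  have z0 : - eps < 0 < eps by rewrite oppr_lt0 eps0.
  have [yr fy] := yP 0 z0; apply: inj => //; first by rewrite subrr normr0 ltW.
  by rewrite fy scale0r addr0 fp0.
pose I : set R := `]- eps, eps[%classic.
have oI : open I by exact: interval_open.
have IE t : I t -> - eps < t < eps by rewrite /I /= in_itv.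
have ylip s t : I s -> I t -> `|y s - y t| <= 2 * `|w| * `|s - t|.
  move=> /IE/yP[sr fs] /IE/yP[tr ft].
  have := near_identity_expand (Lr _ _ sr tr).
  by rewrite fs ft opprD addrACA subrr add0r -scalerBl normrZ mulrA mulrAC.
pose A (i : 'I_n) t := 'D_(e i) f (y t).
have dfy t : I t -> differentiable f (y t).
  by move=> /IE/yP[/Dr[Uy _] _]; case: (cf 1) => df _; exact: df.
have AE t v : I t -> lincomb c A t v = 'D_v f (y t).
  by move=> It; rewrite (derive_coord v ce) //; exact: dfy.
have bA t v : I t -> `|v| <= 2 * `|lincomb c A t v|.
  move=> It; rewrite AE //; have [yr _] := yP t (IE t It).
  have [_ /(_ v)] := Dr _ yr; have := ler_normB ('D_v f (y t)) ('D_v f (y t) - v).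
  by rewrite opprB addrC subrK; lra.
have sA t b : I t -> exists v, lincomb c A t v = b.
  move=> It; have [yr _] := yP t (IE t It); have [_ H] := Dr _ yr.
  by have [v Dv] := derive_surjective (dfy t It) H b; exists v; rewrite AE.
have dy t : I t -> differentiable y t /\ lincomb c A t ('D_1 y t) = w.
  move=> It; have [u Au] := sA t w It.
  have linL : linear (fun h : R => h *: u).
    by move=> k x z; rewrite scalerDl scalerA.
  pose LM := GRing.isLinear.Build _ _ _ _ _ linL.
  pose L : {linear R -> E} := HB.pack (fun h : R => h *: u) LM.
  have cL : continuous L by move=> x; apply: cvgZr_tmp; exact: cvg_id.
  have [|dy Ly] := @differentiable_boundP R _ _ y t L cL; last first.
    by split=> //; rewrite deriveE // Ly /= scale1r.
  move=> d d0; pose d' := d / 2 / (2 * (`|w| + 1)).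
  have d'0 : 0 < d' by rewrite !divr_gt0 // mulr_gt0.
  have cvt : (fun h : R => h + t) @ (0 : R) --> t.
    have : (fun h : R => h + t) @ (0 : R) --> 0 + t.
      by apply: cvgD; [exact: cvg_id|exact: cvg_cst].
    by rewrite add0r.
  have nI : \forall h \near (0 : R), I (h + t).
    by apply: (cvt I); exact: open_nbhs_nbhs.
  have nf := differentiable_bound (dfy t It) d'0.
  have [rho /= rho0 Hrho] := (nbhs_ballP _ _).1 nf.
  have nh : \forall h \near (0 : R), `|h| < rho / (2 * (`|w| + 1)).
    by apply: nbhs0_lt; rewrite divr_gt0 // mulr_gt0.
  apply: filterS2 nI nh => h Ih hs.
  have yh : `|y (h + t) - y t| <= 2 * (`|w| + 1) * `|h|.
    have := ylip _ _ Ih It; rewrite addrK => /le_trans; apply.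
    by rewrite ler_wpM2r // ler_pM2l // lerDl.
  have /Hrho : ball (0 : E) rho (y (h + t) - y t).
    rewrite -ball_normE /= sub0r normrN (le_lt_trans yh) // mulrC.
    by rewrite -ltr_pdivlMr // mulr_gt0.
  rewrite /= subrK; set dl := y (h + t) - y t => H.
  rewrite (le_trans (bA t _ It)) // lincombB lincombZ Au AE //.
  rewrite deriveE ?dfy //; last exact: dfy.
  have [_ fy1] := yP _ (IE _ Ih); have [_ fy0] := yP _ (IE _ It).
  move: H; rewrite fy1 fy0 opprD addrACA subrr add0r -scalerBl addrK distrC => H.
  apply: (@le_trans _ _ (2 * (d' * `|dl|))); first by rewrite ler_pM2l.
  apply: (@le_trans _ _ (2 * (d' * (2 * (`|w| + 1) * `|h|)))).
    by rewrite ler_pM2l // ler_pM2l.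
  suff -> : 2 * (d' * (2 * (`|w| + 1) * `|h|)) = d * `|h| by [].
  by rewrite /d'; field; rewrite gt_eqF.
exists r, eps, y; split=> //; first by move=> x /Dr[].
split=> // k; elim: k => [|k IH].
  by move=> t It; apply: differentiable_continuous; have [] := dy t It.
apply: Ck_on_curve => // [t It|]; first by have [] := dy t It.
apply: (@Ck_lincomb_solution _ _ _ _ _ cc ce I oI k A (fun=> w)) => //.
- move=> i; apply: (Ck_on_comp (U' := U) (g := 'D_(e i) f) (f := y) fE fE oI _ IH).
    by move=> t /IE/yP[/Dr[]].
  by case: (cf k.+1) => _; exact.
- exact: Ck_on_cst.
- by move=> t It; have [] := dy t It.
Qed.

End InverseCurve.

(** * Linearizing an action of a compact group at a fixed point *)

Section VectorMean.
Variables (R : realType) (G : lieGroupType R) (E : normedModType R).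
Hypothesis compactG : compact [set: G].
Variables (n : nat) (e : 'I_n -> E) (c : 'I_n -> {linear E -> R}).
Hypothesis cc : forall i, continuous (c i).
Hypothesis ce : forall v, v = \sum_i c i v *: e i.
Implicit Types g : G -> E.

Definition vmean g : E := \sum_i mean (c i \o g) *: e i.

Let fE : fin_dim E. Proof. by exists n, e, c. Qed.

Lemma linear_comp_continuous (W : normedModType R) (A : {linear E -> W}) g :
  continuous g -> continuous (A \o g).
Proof.
move=> cg x; apply: continuous_comp; first exact: cg.
exact: fin_dim_linear_continuous.
Qed.

Lemma linear_vmean (l : {linear E -> R}) g : continuous g ->
  l (vmean g) = mean (l \o g).
Proof.
move=> cg; rewrite /vmean linear_sum.
have -> : l \o g = fun a => \sum_i l (e i) * (c i \o g) a.
  apply/funext => a; rewrite /= [in LHS](ce (g a)) linear_sum.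
  by apply: eq_bigr => i _; rewrite linearZ /= mulrC.
rewrite mean_sum // => [|i].
  apply: eq_bigr => i _; rewrite linearZ /= meanZ //; first by rewrite mulrC.
  exact: linear_comp_continuous.
move=> a; apply: cvgM; first exact: cvg_cst.
exact: linear_comp_continuous.
Qed.

Lemma vmean_linear (A : {linear E -> E}) g : continuous g ->
  A (vmean g) = vmean (A \o g).
Proof.
move=> cg; rewrite [LHS]ce; apply: eq_bigr => i _.
by congr (_ *: _); exact: (linear_vmean (c i \o A) cg).
Qed.

Lemma vmean_mulgr g b : continuous g -> vmean (fun a => g (a * b)%g) = vmean g.
Proof.
move=> cg; apply: eq_bigr => i _; congr (_ *: _).
by apply: (@mean_mulgr _ _ compactG (c i \o g)); exact: linear_comp_continuous.
Qed.

Lemma vmean_mulgl g b : continuous g -> vmean (fun a => g (b * a)%g) = vmean g.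
Proof.
move=> cg; apply: eq_bigr => i _; congr (_ *: _).
by apply: (@mean_mulgl _ _ compactG (c i \o g)); exact: linear_comp_continuous.
Qed.

End VectorMean.

Section FixedCurve.
Variables (R : realType) (G : lieGroupType R) (E : normedModType R).
Hypothesis compactG : compact [set: G].
Hypothesis fE : fin_dim E.
Variables (U : set E) (oU : open U) (p0 : E) (Up0 : U p0) (beta : G * E -> E).
Hypothesis cbeta : forall k, Ck_fam k (setT `*` U) beta.
Hypothesis beta_p0 : forall a, beta (a, p0) = p0.
Hypothesis beta1 : forall x, U x -> beta (1%g, x) = x.
Hypothesis betaM : forall a b x, U x -> U (beta (b, x)) ->
  beta ((a * b)%g, x) = beta (a, beta (b, x)).
Variables (proj : {linear E -> R}) (w0 : E).
Hypothesis proj_beta : forall a x, U x -> proj (beta (a, x)) = proj x.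
Hypothesis proj_w0 : proj w0 = 1.

(** The representation of [G] on the tangent space at the fixed point. *)
Definition isotropy (a : G) : {linear E -> E} := 'd (fun x => beta (a, x)) p0.

Local Notation L := isotropy.

Let nU : nbhs p0 U. Proof. exact: open_nbhs_nbhs. Qed.

Let dbeta a x : U x -> differentiable (fun x => beta (a, x)) x.
Proof. by move=> Ux; case: (cbeta 1) => _ [d _]; exact: (d (a, x)). Qed.

Lemma near_beta : \forall x \near p0, U x /\ forall a, U (beta (a, x)).
Proof.
have [r /= r0 rU] := (nbhs_ballP _ _).1 nU.
have r20 : 0 < r / 2 by rewrite divr_gt0.
have := uniformly_close compactG (F := beta) (x := p0) r20.
move=> /(_ (fun a => Ck_fam_continuous (cbeta 0) (p := (a, p0)) (conj I Up0))) H.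
apply: filterS2 nU H => x Ux Hx; split=> // a; apply: rU.
have := Hx a; rewrite beta_p0 -ball_normE /= distrC => /le_lt_trans; apply.
by rewrite ltr_pdivrMr // ltr_pMr // ltr1n.
Qed.

Lemma isotropy1 v : L 1%g v = v.
Proof.
rewrite /L -deriveE; last exact: dbeta.
rewrite (@near_eq_derive _ _ _ _ id) ?derive_id //.
by apply: filterS nU => x; exact: beta1.
Qed.

Lemma isotropyM a b v : L (a * b)%g v = L a (L b v).
Proof.
pose f x := beta (b, x); pose g x := beta (a, x).
have df : differentiable f p0 by exact: dbeta.
have dg : differentiable g (f p0) by rewrite /f beta_p0; exact: dbeta.
have E1 : 'D_v (fun x => beta ((a * b)%g, x)) p0 = 'D_v (g \o f) p0.
  by apply: near_eq_derive; apply: filterS near_beta => x [Ux Ub]; exact: betaM.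
have E2 := derive_comp v df dg.
rewrite /L -(deriveE v (dbeta (a * b)%g Up0)) E1 E2.
by rewrite (deriveE v df) {1}/f beta_p0 (deriveE _ (dbeta a Up0)).
Qed.

Lemma proj_isotropy a v : proj (L a v) = proj v.
Proof.
have cp : continuous proj by exact: fin_dim_linear_continuous.
have dp x : differentiable proj x by exact: linear_differentiable.
have E1 : 'D_v (proj \o (fun x => beta (a, x))) p0 = 'D_v proj p0.
  by apply: near_eq_derive; apply: filterS nU => x; exact: proj_beta.
have pE x u : 'D_u proj x = proj u by rewrite (deriveE _ (dp x)) diff_lin.
rewrite -(pE p0 v) -E1 (derive_comp v (dbeta a Up0) (dp _)) pE -deriveE //.
exact: dbeta.
Qed.

Lemma isotropy_continuous v : continuous (fun a => L a v).
Proof.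
have -> : (fun a => L a v) = (fun a => 'D_v (fun x => beta (a, x)) p0).
  by apply/funext => a; rewrite deriveE //; exact: dbeta.
have [_ [_ D]] := cbeta 1.
exact: (@fam_slice_continuous R G E U E 0 _ p0 (D v) Up0).
Qed.

(** The mean [Phi] over [a] of [L a^-1 \o beta (a, _)] is tangent to the
    identity at [p0] and conjugates [beta] with the linear action [L] near
    [p0], as the invariance of the mean shows. The vector [w0], averaged over
    [G], gives an [L]-invariant vector [w] on which [proj] is still 1. The
    preimage by [Phi] of the line through [p0] directed by [w] consists of
    fixed points, since [Phi] is injective near [p0]. *)
Theorem fixed_curve : exists (eps : R) (y : R -> E),
  [/\ 0 < eps, y 0 = p0, Cinfty_on (`]- eps, eps[%classic : set R) y &
     forall t, - eps < t < eps ->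
       [/\ U (y t), forall a, beta (a, y t) = y t & proj (y t) = proj p0 + t]].
Proof.
have [n [e [c [cc ce]]]] := fE.
pose vm : (G -> E) -> E := vmean e c.
pose H (p : G * E) := L p.1^-1%g (beta p - p0).
have oGU : open ([set: G] `*` U) by exact: open_setTX.
(* [H] is a combination of coordinates of [beta], with coefficients that are
   continuous in [a] and constant in [x]. *)
have cH k : Ck_fam k (setT `*` U) H.
  have -> : H = (fun p => \sum_i c i (beta p - p0) *: L p.1^-1%g (e i)).
    apply/funext => p; rewrite /H [in LHS](ce (beta p - p0)) linear_sum.
    by apply: eq_bigr => i _; rewrite linearZ.
  apply: (@Ck_fam_sum _ _ _ _ _ _ _
    (fun i p => c i (beta p - p0) *: L p.1^-1%g (e i))) => // i.
  apply: Ck_famZ => //; last first.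
    apply: (Ck_fam_param _ _ (u := fun a => L a^-1%g (e i))) => p _.
    apply: (@continuous_comp _ _ _ (fun a : G => a^-1%g) (fun a => L a (e i))).
      exact: lie_invg_continuous.
    exact: isotropy_continuous.
  apply: (Ck_fam_linear (F := fun p => beta p - p0)) => //.
  apply: (Ck_famD (G := fun=> - p0)) => //.
  by apply: (Ck_fam_param _ _ (u := fun=> - p0)) => p _; exact: cst_continuous.
have cHx x : U x -> continuous (fun a => H (a, x)).
  by move=> Ux; exact: (fam_slice_continuous (cH 0) Ux).
have ccH k i : Ck_fam k (setT `*` U) (c i \o H) by exact: Ck_fam_linear.
pose Phi x := p0 + vm (fun a => H (a, x)).
pose m i x := mean (fun a => (c i \o H) (a, x)).
have PhiE : Phi = (fun=> p0) + \sum_i (fun x => m i x *: e i).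
  by apply/funext => x; rewrite /Phi -![(_ + _ : E -> E) _]/(_ + _) fct_sumE.
have cPhi : Cinfty_on U Phi.
  move=> k; rewrite PhiE.
  have -> : (fun=> p0) + \sum_i (fun x => m i x *: e i) =
      (fun=> p0) \+ (fun x => \sum_i m i x *: e i).
    by apply/funext => x; rewrite -![(_ + _ : E -> E) _]/(_ + _) fct_sumE.
  apply: Ck_onD => //; first exact: Ck_on_cst.
  apply: (@Ck_on_sum _ _ _ _ _ _ (fun i x => m i x *: e i)) => // i.
  apply: Ck_onZ => //; last exact: Ck_on_cst.
  exact: (Ck_mean compactG fE oU (ccH k i)).
have Phip0 : Phi p0 = p0.
  rewrite /Phi /vm /vmean big1 ?addr0 // => i _.
  rewrite (_ : _ \o _ = cst 0) ?mean_const ?scale0r //.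
  by apply/funext => a; rewrite /H /= beta_p0 subrr !linear0.
(* The derivative of the integrand at [p0] is [L a^-1 \o L a = id]. *)
have DPhi v : 'D_v Phi p0 = v.
  have dm i : differentiable (m i) p0 /\ 'D_v (m i) p0 = c i v.
    have [dm Dm] := mean_differentiable compactG fE oU (ccH 1 i) Up0.
    split=> //; rewrite Dm; rewrite (_ : (fun a => _) = cst (c i v)) ?mean_const //.
    apply/funext => a /=.
    have db := dbeta a Up0.
    have dA : differentiable (fun x => beta (a, x) - p0) p0 by exact: differentiableB.
    have cL : continuous (L a^-1%g) by exact: fin_dim_linear_continuous.
    have dL : differentiable (L a^-1%g) (beta (a, p0) - p0).
      exact: linear_differentiable.
    have dc : differentiable (c i) ((L a^-1%g \o (fun x => beta (a, x) - p0)) p0).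
      exact: linear_differentiable.
    rewrite (derive_comp v (differentiable_comp dA dL) dc) (derive_linear _ _ (cc i)).
    rewrite (derive_comp v dA dL) (derive_linear _ _ cL).
    have -> : 'D_v (fun x => beta (a, x) - p0) p0 = L a v.
      have := @deriveB _ _ _ (fun x => beta (a, x)) (cst p0) p0 v
        (diff_derivable db) (derivable_cst _ _ _).
      move=> ->; by rewrite derive_cst subr0 (deriveE v db).
    by rewrite -isotropyM mulVg isotropy1.
  have dme i : differentiable (fun x => m i x *: e i) p0.
    by apply: differentiableZl; case: (dm i).
  have d1 : derivable (fun=> p0) p0 v by exact: derivable_cst.
  have d2 : derivable (\sum_i (fun x => m i x *: e i)) p0 v.
    by apply: diff_derivable; exact: differentiable_sum.
  rewrite PhiE (deriveD d1 d2) derive_cst add0r.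
  rewrite derive_sum => [|i]; last exact: diff_derivable.
  rewrite [RHS]ce; apply: eq_bigr => i _; have [dmi Dmi] := dm i.
  by rewrite deriveE // diffZl //= -deriveE // Dmi.
(* Substitute [a * b] for [a] under the mean. *)
have Phi_equiv b x : U x -> U (beta (b, x)) ->
    Phi (beta (b, x)) - p0 = L b (Phi x - p0).
  move=> Ux Ub; rewrite /Phi addrAC subrr add0r addrAC subrr add0r.
  rewrite /vm (vmean_linear compactG cc ce) //; last exact: cHx.
  rewrite -[RHS](vmean_mulgr compactG cc ce b); last first.
    exact: (linear_comp_continuous cc ce (cHx _ Ux)).
  congr (vmean _ _ _); apply/funext => a.
  rewrite /H /= -isotropyM invgM mulgA mulgV mul1g betaM //.
have proj_Phi x : U x -> proj (Phi x) = proj x.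
  move=> Ux; rewrite /Phi linearD /vm (linear_vmean compactG cc ce); last exact: cHx.
  have -> : proj \o (fun a => H (a, x)) = cst (proj x - proj p0).
    by apply/funext => a; rewrite /= /H proj_isotropy linearB proj_beta.
  by rewrite (mean_const compactG) addrC subrK.
pose w := vm (fun a => L a w0).
have Lw b : L b w = w.
  rewrite /w /vm (vmean_linear compactG cc ce); last exact: isotropy_continuous.
  rewrite -[RHS](vmean_mulgl compactG cc ce b); last exact: isotropy_continuous.
  by congr (vmean _ _ _); apply/funext => a; rewrite /= isotropyM.
have proj_w : proj w = 1.
  rewrite /w /vm (linear_vmean compactG cc ce); last exact: isotropy_continuous.
  have -> : proj \o (fun a => L a w0) = cst 1.
    by apply/funext => a; rewrite /= proj_isotropy.
  exact: mean_const.
have [r [d [y [r0 d0 rU inj [y0 cy yP]]]]] := inverse_curve fE oU Up0 cPhi Phip0 DPhi w.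
(* Both [y t] and its images have to lie in the ball where [Phi] is injective. *)
have nr : \forall x \near p0, forall a, `|beta (a, x) - p0| <= r.
  have := uniformly_close compactG (F := beta) (x := p0) r0.
  move=> /(_ (fun a => Ck_fam_continuous (cbeta 0) (p := (a, p0)) (conj I Up0))).
  by apply: filterS => x Hx a; have := Hx a; rewrite beta_p0.
have ny : \forall t \near (0 : R), forall a, `|beta (a, y t) - p0| <= r.
  have : {for 0, continuous y}.
    by apply: (Ck_on_continuous (cy 0)); rewrite /= in_itv /= oppr_lt0 d0.
  by rewrite /prop_for /continuous_at y0 => cy0; exact: (cy0 _ nr).
have [s /= s0 sP] := (nbhs_ballP _ _).1 ny.
exists (Num.min s d), y.
have sub t : - Num.min s d < t < Num.min s d -> - d < t < d.
  by rewrite -!ltr_norml lt_min => /andP[].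
split=> //; first by rewrite lt_min s0.
  move=> k; apply/Ck_on_famP; apply: Ck_fam_sub ((Ck_on_famP _ _ _).1 (cy k)).
  by move=> p [_ /=]; rewrite !in_itv /= => /sub.
move=> t ts; have td := sub _ ts; have [yr Py] := yP _ td.
have Uy := rU _ yr.
have br a : `|beta (a, y t) - p0| <= r.
  apply: (sP t); rewrite -ball_normE /= sub0r normrN.
  by move: ts; rewrite -ltr_norml lt_min => /andP[].
split=> // [a|].
  apply: inj => //; apply: (addIr (- p0)); rewrite Phi_equiv //; last exact/rU/br.
  by rewrite Py addrAC subrr add0r linearZ /= Lw.
by rewrite -proj_Phi // Py linearD linearZ /= proj_w; congr (_ + _); exact: mulr1.
Qed.

End FixedCurve.

(** * Families of points of a manifold *)

Lemma open_preimage_on (X Y : topologicalType) (O : set X) (D : set Y)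
    (F : X -> Y) : open O -> (forall p, O p -> {for p, continuous F}) ->
  open D -> open (O `&` F @^-1` D).
Proof.
move=> oO cF oD; rewrite openE => p [Op FD]; rewrite /interior.
apply: filterI; first exact: open_nbhs_nbhs.
by apply: (cF _ Op); exact: open_nbhs_nbhs.
Qed.

Section SmoothFamilies.
Variables (R : realType) (T : topologicalType) (E : normedModType R).

(** The counterpart of [smooth_on] for maps that are smooth in the second
    variable only, in the sense of [Ck_fam]. *)
Definition smooth_fam (M : topologicalType) (EM : normedModType R)
    (AM : set (chart M EM)) (O : set (T * E)) (F : T * E -> M) : Prop :=
  (forall p, O p -> {for p, continuous F}) /\
  (forall c k, AM c -> Ck_fam k (O `&` F @^-1` cdom c) (cmap c \o F)).

Lemma smooth_fam_param (M : topologicalType) (EM : normedModType R)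
    (AM : set (chart M EM)) (O : set (T * E)) (u : T -> M) :
  is_smooth_atlas AM -> continuous u -> smooth_fam AM O (fun p => u p.1).
Proof.
move=> sA cu; split.
  by move=> p _; apply: continuous_comp; [exact: cvg_fst|exact: cu].
move=> c k Ac; apply: (Ck_fam_param _ _ (u := cmap c \o u)) => p [_ /= up].
apply: continuous_comp; first exact: cu.
exact: (chart_continuous (atlas_chart sA Ac)).
Qed.

(** In charts around [F1 p] and [F2 p], the composite is the coordinate
    expression of [g] after the pair of coordinate expressions of [F1] and
    [F2]. *)
Lemma smooth_fam_comp2 (M1 M2 M3 : topologicalType)
    (E1 E2 E3 : normedModType R) (A1 : set (chart M1 E1))
    (A2 : set (chart M2 E2)) (A3 : set (chart M3 E3)) (O : set (T * E))
    (F1 : T * E -> M1) (F2 : T * E -> M2) (g : M1 * M2 -> M3) :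
  fin_dim E1 -> fin_dim E2 -> fin_dim E3 ->
  is_smooth_atlas A1 -> is_smooth_atlas A2 -> is_smooth_atlas A3 ->
  open O -> smooth (prod_atlas A1 A2) A3 g ->
  smooth_fam A1 O F1 -> smooth_fam A2 O F2 ->
  smooth_fam A3 O (fun p => g (F1 p, F2 p)).
Proof.
move=> f1 f2 f3 sA1 sA2 sA3 oO [cg sg] [cF1 sF1] [cF2 sF2].
have cF p : O p -> {for p, continuous (fun p => g (F1 p, F2 p))}.
  move=> Op; apply: (@continuous_comp _ _ _ (fun p => (F1 p, F2 p)) g).
    by apply: cvg_pair; [exact: cF1|exact: cF2].
  exact: cg.
split=> // c3 k Ac3; apply: Ck_fam_local => p [Op Fp].
have [c1 Ac1 p1] := atlas_cover sA1 (F1 p).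
have [c2 Ac2 p2] := atlas_cover sA2 (F2 p).
pose O1 := O `&` F1 @^-1` cdom c1; pose O2 := O `&` F2 @^-1` cdom c2.
pose O3 := O `&` (fun p => g (F1 p, F2 p)) @^-1` cdom c3.
have oO1 : open O1.
  by apply: open_preimage_on => //; exact: (chart_open_dom (atlas_chart sA1 Ac1)).
have oO2 : open O2.
  by apply: open_preimage_on => //; exact: (chart_open_dom (atlas_chart sA2 Ac2)).
have oO3 : open O3.
  by apply: open_preimage_on => //; exact: (chart_open_dom (atlas_chart sA3 Ac3)).
pose N := O1 `&` O2 `&` O3.
have oN : open N by apply: openI => //; exact: openI.
exists N; first by [].
pose c12 := prod_chart c1 c2.
have A12 : prod_atlas A1 A2 c12 by exists c1 => //; exists c2.
apply: (@eq_Ck_fam _ _ _ _ _ _ ((cmap c3 \o g \o cinv c12) \o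
    (fun p => ((cmap c1 \o F1) p, (cmap c2 \o F2) p)))) => //.
  move=> q [[[_ q1] [_ q2]] _] /=.
  by rewrite (chartK (atlas_chart sA1 Ac1)) // (chartK (atlas_chart sA2 Ac2)).
apply: (Ck_fam_comp (U := cmap c12 @` (setT `&` cdom c12 `&` g @^-1` cdom c3))) => //.
- exact: fin_dim_prod.
- move=> q [[[_ q1] [_ q2]] [_ q3]]; exists (F1 q, F2 q) => //.
- apply: Ck_fam_pair => //.
    by apply: Ck_fam_sub (sF1 c1 k Ac1) => q [[]].
  by apply: Ck_fam_sub (sF2 c2 k Ac2) => q [[]].
- exact: sg.
Qed.

Lemma Ck_fam_proj k (O : set (T * E)) : Ck_fam k O snd.
Proof.
apply: (@Ck_fam_sub _ _ _ _ _ (setT `*` setT)) => //.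
apply: (Ck_fam_snd T (f := id)); case: k => [|k]; first by move=> x _; exact: cvg_id.
split=> [x _|v]; first exact: ex_diff.
have -> : 'D_v id = (fun=> v : E) by apply/funext => x; rewrite derive_id.
exact: Ck_on_cst.
Qed.

Lemma smooth_fam_vec (V : normedModType R) (O : set (T * E))
    (l : {linear E -> V}) : open O -> continuous l ->
  smooth_fam (@vec_atlas R V) O (fun p => l p.2).
Proof.
move=> oO cl; split.
  by move=> p _; apply: continuous_comp; [exact: cvg_snd|exact: cl].
move=> c k ->; apply: (@Ck_fam_sub _ _ _ _ _ O); first by move=> p [].
by apply: (Ck_fam_linear (F := snd)) => //; exact: Ck_fam_proj.
Qed.

Lemma smooth_fam_cinv (M : topologicalType) (EM : normedModType R)
    (AM : set (chart M EM)) (c : chart M EM) (l : {linear E -> EM}) :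
  fin_dim EM -> is_smooth_atlas AM -> AM c -> continuous l ->
  smooth_fam AM [set p | (cmap c @` cdom c) (l p.2)]
    (fun p => cinv c (l p.2)).
Proof.
move=> fM sA Ac cl; have chc := atlas_chart sA Ac.
set O := [set p | _].
have oO : open O.
  apply: (@open_comp _ _ (fun p : T * E => l p.2)) => [p _|].
    by apply: continuous_comp; [exact: cvg_snd|exact: cl].
  exact: chart_open_codom.
have cF p : O p -> {for p, continuous (fun p : T * E => cinv c (l p.2))}.
  move=> Op; apply: (@continuous_comp _ _ _ (fun p : T * E => l p.2) (cinv c)).
    by apply: continuous_comp; [exact: cvg_snd|exact: cl].
  exact: (chart_inv_continuous chc).
split=> // d k Ad; have chd := atlas_chart sA Ad.
apply: (Ck_fam_comp (F := fun p => l p.2) (g := cmap d \o cinv c)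
  (U := cmap c @` (cdom c `&` cdom d))) => //.
- by apply: open_preimage_on => //; exact: chart_open_dom.
- move=> p [[x cx xl]]; rewrite /= -xl (chartK chc) // => dx; by exists x.
- apply: (Ck_fam_linear (F := snd)) => //; last exact: Ck_fam_proj.
  by apply: open_preimage_on => //; exact: chart_open_dom.
- exact: (atlas_transition sA Ac Ad k).
Qed.

End SmoothFamilies.

Lemma vec_atlas_smooth (R : realType) (E : normedModType R) :
  is_smooth_atlas (@vec_atlas R E).
Proof.
split.
- move=> c ->; split=> //=; rewrite ?image_id; try exact: openT.
  + by move=> x _; exact: cvg_id.
  + by move=> x _; exact: cvg_id.
- by move=> x; exists (Chart setT id id).
- move=> c d -> -> /= k; apply/Ck_on_famP.
  by apply: Ck_fam_sub (Ck_fam_proj k (setT : set (R * E))).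
Qed.

(** * Deformations of crossed homomorphisms *)

Section Deformation.
Variables (R : realType) (G H : lieGroupType R).
Hypothesis compactG : compact [set: G].
Variables (Theta : G -> H -> H) (actTheta : is_lie_action Theta).

Local Notation A := (@lie_atlas R H).
Local Notation EH := 'rV[R]_(@lie_dim R H).

Let sAG : is_smooth_atlas (@lie_atlas R G).
Proof. exact: manifold_atlas (@lie_manifold R G). Qed.

Let sAH : is_smooth_atlas A.
Proof. exact: manifold_atlas (@lie_manifold R H). Qed.

Lemma lie_action_fix1 a : Theta a 1%g = 1%g.
Proof.
have aM := lie_autM (lie_action_aut actTheta a).
by apply: (@mulgI _ (Theta a 1%g)); rewrite -aM !mulg1.
Qed.

Lemma lie_actionV a x : Theta a x^-1%g = (Theta a x)^-1%g.
Proof.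
have aM := lie_autM (lie_action_aut actTheta a).
by apply: (@mulgI _ (Theta a x)); rewrite -aM !mulgV lie_action_fix1.
Qed.

Lemma crossed_hom1 D : is_crossed_hom Theta D -> D 1%g = 1%g.
Proof.
move=> cD; apply: (@mulgI _ (D 1%g)).
by rewrite mulg1 -{2}[D 1%g](lie_action1 actTheta) -crossed_homM // mulg1.
Qed.

Section TwistedAction.
Variables (D : G -> H) (DD : G * R -> H).
Hypothesis cD : is_crossed_hom Theta D.
Hypothesis dDD : is_deformation Theta D DD.

(** For fixed [t] this is an action of [G] on [H], as both [D_t] and [D] are
    crossed homomorphisms; a fixed point of it is an element that
    conjugates [D] to [D_t]. *)
Definition twist (t : R) (a : G) (h : H) : H :=
  (DD (a, t) * Theta a h * (D a)^-1)%g.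

Lemma twist1 t h : twist t 1%g h = h.
Proof.
rewrite /twist (lie_action1 actTheta) (crossed_hom1 cD) invg1 mulg1.
by rewrite (crossed_hom1 (deformation_crossed_hom dDD t)) mul1g.
Qed.

Lemma twistM t a b h : twist t (a * b)%g h = twist t a (twist t b h).
Proof.
have aM := lie_autM (lie_action_aut actTheta a).
rewrite /twist !aM (lie_actionM actTheta) lie_actionV (crossed_homM cD) invgM.
by rewrite (crossed_homM (deformation_crossed_hom dDD t)) !mulgA.
Qed.

Lemma twist0 a : twist 0 a 1%g = 1%g.
Proof. by rewrite /twist lie_action_fix1 mulg1 (deformation0 dDD) mulgV. Qed.

Lemma twist_fixed t a h : twist t a h = h ->
  DD (a, t) = (h * D a * Theta a (h^-1))%g.
Proof.
by move=> th; rewrite -{1}th lie_actionV /twist mulgVK mulgK.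
Qed.

Lemma twist_smooth_fam (c : chart H EH) : A c ->
  smooth_fam A
    [set p : G * (R * EH) | (cmap c @` cdom c) p.2.2]
    (fun p => twist p.2.1 p.1 (cinv c p.2.2)).
Proof.
move=> Ac.
pose fstL : {linear (R * EH)%type -> R} := fst.
pose sndL : {linear (R * EH)%type -> EH} := snd.
have cfst : continuous fstL by move=> p; exact: cvg_fst.
have csnd : continuous sndL by move=> p; exact: cvg_snd.
set O := [set p | _].
have sI := smooth_fam_cinv G (fin_dim_row R _) sAH Ac csnd.
have oO : open O.
  apply: (@open_comp _ _ (fun p : G * (R * EH) => p.2.2)) => [p _|].
    by apply: continuous_comp; [exact: cvg_snd|exact: csnd].
  exact: chart_open_codom (atlas_chart sAH Ac).
have fE : fin_dim EH := fin_dim_row R _.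
have fG : fin_dim 'rV[R]_(@lie_dim R G) := fin_dim_row R _.
have fR : fin_dim R := fin_dim_scalar R.
have sV := @vec_atlas_smooth R R.
have sp1 : smooth_fam (@lie_atlas R G) O (fun p => p.1).
  by apply: (smooth_fam_param O (u := fun a => a)) => // a; exact: cvg_id.
have sD : smooth_fam A O (fun p => (D p.1)^-1%g).
  apply: (smooth_fam_param O (u := fun a => (D a)^-1%g)) => // a.
  apply: (@continuous_comp _ _ _ D (fun x : H => x^-1%g)).
    by case: (crossed_hom_smooth cD) => cD' _; exact: cD'.
  exact: lie_invg_continuous.
have st : smooth_fam (@vec_atlas R R) O (fun p => p.2.1).
  exact: (smooth_fam_vec oO cfst).
have sDD := smooth_fam_comp2 fG fR fE sAG sV sAH oO (deformation_smooth dDD) sp1 st.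
have sT := smooth_fam_comp2 fG fE fE sAG sAH sAH oO (lie_action_smooth actTheta) sp1 sI.
have s1 := smooth_fam_comp2 fE fE fE sAH sAH sAH oO (@smooth_mulg R H) sDD sT.
exact: (smooth_fam_comp2 fE fE fE sAH sAH sAH oO (@smooth_mulg R H) s1 sD).
Qed.

(** In a chart around 1 and with the time as an additional coordinate, the
    actions [twist t] form one action near the fixed point [(0, 1)], which
    preserves the time. A curve of fixed points along which the time has
    derivative 1 is a family of fixed points of [twist t]. *)
Theorem deformation_trivial : is_trivial_deformation Theta D DD.
Proof.
have [c Ac c1] := atlas_cover sAH 1%g.
have chc := atlas_chart sAH Ac.
pose E : normedModType R := (R * EH)%type.
have fEH : fin_dim EH := fin_dim_row R _.
have fE : fin_dim E := fin_dim_prod (fin_dim_scalar R) fEH.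
pose fstL : {linear E -> R} := fst.
pose sndL : {linear E -> EH} := snd.
have cfst : continuous fstL by move=> p; exact: cvg_fst.
have csnd : continuous sndL by move=> p; exact: cvg_snd.
pose alpha (p : G * E) := twist p.2.1 p.1 (cinv c p.2.2).
pose O1 := [set p : G * E | (cmap c @` cdom c) p.2.2].
have [calpha salpha] : smooth_fam A O1 alpha by exact: twist_smooth_fam.
have oO1 : open O1.
  apply: (@open_comp _ _ (fun p : G * E => p.2.2)) => [p _|].
    by apply: continuous_comp; [exact: cvg_snd|exact: csnd].
  exact: chart_open_codom.
pose O2 := O1 `&` alpha @^-1` cdom c.
have oO2 : open O2.
  by apply: open_preimage_on => //; exact: (chart_open_dom chc).
(* [beta] below is meaningful on [O2]; compactness of [G] gives a neighbourhood
   of [p0] on which it is so for all [a] at once. *)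
pose U : set E := [set x | forall a, O2 (a, x)]^°%classic.
have oU : open U by exact: open_interior.
have UO2 a x : U x -> O2 (a, x) by move=> /interior_subset; exact.
pose p0 : E := (0, cmap c 1%g).
have cinv1 : cinv c (cmap c 1%g) = 1%g by exact: (chartK chc).
have alpha0 a : alpha (a, p0) = 1%g by rewrite /alpha /= cinv1 twist0.
have Up0 : U p0.
  apply: (tube_lemma compactG (O := O2)) => a; apply: open_nbhs_nbhs; split=> //.
  split; first by exists 1%g.
  by rewrite /preimage /= alpha0.
pose beta (p : G * E) : E := (p.2.1, cmap c (alpha p)).
have cbeta k : Ck_fam k (setT `*` U) beta.
  apply: Ck_fam_pair; first exact: open_setTX.
    apply: (Ck_fam_linear (F := snd) (L := fstL)) => //; first exact: open_setTX.
    exact: Ck_fam_proj.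
  apply: Ck_fam_sub (salpha c k Ac) => -[a x] [_ Ux]; exact: UO2.
have beta_p0 a : beta (a, p0) = p0 by rewrite /beta alpha0.
have beta1 x : U x -> beta (1%g, x) = x.
  move=> /(UO2 1%g)[[h ch hx] _]; rewrite /beta /alpha twist1 /=.
  by rewrite -hx (chartK chc) // hx -surjective_pairing.
have betaM a b x : U x -> U (beta (b, x)) ->
    beta ((a * b)%g, x) = beta (a, beta (b, x)).
  move=> /(UO2 b)[_ ab] _; rewrite /beta /alpha /= twistM.
  by rewrite (chartK chc).
have [eps [y [eps0 y0 cy yP]]] := fixed_curve compactG fE oU Up0 cbeta beta_p0
  beta1 betaM (proj := fstL) (w0 := (1, 0)) (fun a x _ => erefl) erefl.
pose I : set R := `]- eps, eps[%classic.
have oI : open I by exact: interval_open.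
have IE t : I t -> - eps < t < eps by rewrite /I /= in_itv.
have y1 t : - eps < t < eps -> (y t).1 = t.
  by move=> /yP[_ _]; rewrite /= add0r.
exists eps, (fun t => cinv c (y t).2); split=> //; last 2 first.
- by rewrite y0.
- move=> a t /[dup] /y1 yt /yP[Uy fy _]; apply: twist_fixed.
  have [[h ch hy] ca] := UO2 a _ Uy; have := congr1 snd (fy a) => /= fya.
  rewrite -[in RHS]fya (chartK chc) //.
  by rewrite /alpha /= yt.
have cyt t : I t -> {for t, continuous (fun t => (y t).2)}.
  move=> It; apply: (@continuous_comp _ _ _ y snd); last exact: csnd.
  exact: (Ck_on_continuous (cy 0) It).
have codom t : I t -> (cmap c @` cdom c) (y t).2.
  by move=> /IE/yP[/(UO2 1%g)[]].
have ct t : I t -> {for t, continuous (fun t => cinv c (y t).2)}.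
  move=> It; apply: (@continuous_comp _ _ _ (fun t => (y t).2) (cinv c)).
    exact: cyt.
  by apply: (chart_inv_continuous chc); exact: codom.
split=> // d0 d -> Ad k /=; rewrite image_id setIT.
have chd := atlas_chart sAH Ad.
have oS : open (I `&` (fun t => cinv c (y t).2) @^-1` cdom d).
  by apply: open_preimage_on => //; exact: (chart_open_dom chd).
apply: (Ck_on_comp (f := sndL \o y) (g := cmap d \o cinv c)
  (U' := cmap c @` (cdom c `&` cdom d)) fEH fEH oS).
- move=> t [It dt]; have [h ch hy] := codom _ It; exists h => //.
  by split=> //; move: dt; rewrite /= -hy (chartK chc).
- apply: Ck_on_linear => //.
  apply/Ck_on_famP; apply: Ck_fam_sub ((Ck_on_famP _ _ _).1 (cy k)).
  by move=> p [_ []].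
- exact: (atlas_transition sAH Ac Ad k).
Qed.

End TwistedAction.
End Deformation.

Theorem proposition3p7 (R : realType) (G H : lieGroupType R)
    (compactG : compact [set: G]%classic)
    (Theta : G -> H -> H) (actTheta : is_lie_action Theta) :
  (forall D : G -> H, is_crossed_hom Theta D ->
     forall DD : G * R -> H,
       is_deformation Theta D DD -> is_trivial_deformation Theta D DD) /\
  (forall D : G -> H, is_crossed_hom Theta D -> is_rigid Theta D).
Proof.
by split=> D cD DD dDD; exact: deformation_trivial.
Qed.
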